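(* Let the map $\mathbf{\Theta}$ (a random finite set of landmarks) have as prior a Poisson point process with rate $\lambda_0^u$ and spatial density $f_0^u(\theta)$, and let $\mathbf{Z}=\mathbf{Z}_1\uplus\cdots\uplus\mathbf{Z}_K$ be a finite batch of (time-tagged) measurements collected at times $k=1,\dots,K$ and generated, conditionally on the static map $\mathbf{\Theta}$, by the standard Poisson extended-object measurement model with clutter described in the context. Then the multi-object batch posterior density of $\mathbf{\Theta}$ given $\mathbf{Z}$ has Poisson multi-Bernoulli mixture form: for every finite set $\mathbf{\Theta}$ of landmark states, $$f(\mathbf{\Theta}\mid\mathbf{Z})=\sum_{\mathbf{\Theta}^d\subseteq\mathbf{\Theta}}\left(\sum_{j=1}^{N_K}W_K^j\sum_{\alpha^j\in P^{|\mathbf{\Theta}^d|}_{I_K^j}}\prod_{i=1}^{I_K^j}f_K^{j,i}\big(\mathbf{\Theta}_{\alpha^j(i)}\big)\right)\left(e^{-\lambda_K^u}\prod_{\theta\in\mathbf{\Theta}\setminus\mathbf{\Theta}^d}\lambda_K^u f_K^u(\theta)\right),$$ where $j=1,\dots,N_K$ indexes all partitions of $\mathbf{Z}$ into non-empty cells $\mathbf{C}^{j,1},\dots,\mathbf{C}^{j,I_K^j}$ ($N_K$ is the Bell number of order $|\mathbf{Z}|$), $\mathbf{V}_k^{j,i}=\mathbf{C}^{j,i}\cap\mathbf{Z}_k$ (possibly empty) is the set of measurements of cell $\mathbf{C}^{j,i}$ with time tag $k$, and $f_K^{j,i}(\cdot)$, evaluated on sets, is the Bernoulli set density with existence probability $r_K^{j,i}$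 and state density $f_K^{j,i}(\theta)$. The parameters are as follows. (1) With $$l_k^{j,i}(\theta)=\begin{cases}p_D^k(\theta)\,e^{-\gamma_k(\theta)}\prod_{\mathbf{z}\in\mathbf{V}_k^{j,i}}\gamma_k(\theta)\phi(\mathbf{z}\mid\theta), & \mathbf{V}_k^{j,i}\neq\emptyset,\\ q_D^k(\theta), & \mathbf{V}_k^{j,i}=\emptyset,\end{cases}\qquad q_D^k(\theta)=1-p_D^k(\theta)+p_D^k(\theta)e^{-\gamma_k(\theta)},$$ $$L_K^{j,i}=\lambda_0^u\Big\langle f_0^u;\prod_{k=1}^K l_k^{j,i}\Big\rangle,$$ the Bernoulli parameters are $$f_K^{j,i}(\theta)=\frac{f_0^u(\theta)\prod_{k=1}^K l_k^{j,i}(\theta)}{\big\langle f_0^u;\prod_{k=1}^K l_k^{j,i}\big\rangle},\qquad r_K^{j,i}=\begin{cases}\dfrac{L_K^{j,i}}{\lambda_c c(\mathbf{z})+L_K^{j,i}}, & |\mathbf{C}^{j,i}|=1\ (\mathbf{C}^{j,i}=\{\mathbf{z}\}),\\[2mm] 1, & |\mathbf{C}^{j,i}|>1.\end{cases}$$ (2) The weights satisfy $\sum_j W_K^j=1$ and $$W_K^j\propto\prod_{i=1}^{I_K^j}\mathcal{L}_K^{j,i},\qquad \mathcal{L}_K^{j,i}=\begin{cases}\lambda_c c(\mathbf{z})+L_K^{j,i}, & |\mathbf{C}^{j,i}|=1\ (\mathbf{C}^{j,i}=\{\mathbf{z}\}),\\ L_K^{j,i}, & |\mathbf{C}^{j,i}|>1.\end{cases}$$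 (3) The Poisson part (undetected landmarks) does not depend on the measurements and has rate and spatial density $$\lambda_K^u=\lambda_0^u\Big\langle f_0^u;\prod_{k=1}^K q_D^k\Big\rangle,\qquad f_K^u(\theta)=\frac{f_0^u(\theta)\prod_{k=1}^K q_D^k(\theta)}{\big\langle f_0^u;\prod_{k=1}^K q_D^k\big\rangle}.$$
   Context: **Notation.** A landmark state is $\theta=(\mu,\Sigma,\omega)$: 2D position $\mu$, extent matrix $\Sigma$, expected number of measurements $\omega>0$; $d\theta$ is the reference measure on the state space. Measurements $\mathbf{z}$ are points of the measurement space. $\langle f;h\rangle=\int f(\theta)h(\theta)\,d\theta$. Empty products equal $1$. For a function $\tau$ of finite sets, the set integral is $\int\tau(\mathbf{\Theta})\,\delta\mathbf{\Theta}=\tau(\emptyset)+\sum_{n\ge1}\frac1{n!}\int\tau(\{\theta_1,\dots,\theta_n\})\,d\theta_1\cdots d\theta_n$, and set densities are normalized with respect to it. **Poisson point process (PPP).** With rate $\lambda\ge 0$ and spatial probability density $f$, its set density is $f(\mathbf{\Theta})=e^{-\lambda}\prod_{\theta\in\mathbf{\Theta}}\lambda f(\theta)$. The prior is $f_0(\mathbf{\Theta})=e^{-\lambda_0^u}\prod_{\theta\in\mathbf{\Theta}}\lambda_0^u f_0^u(\theta)$. **Bernoulli set density.** With existence probability $r$ and state density $f(\theta)$, it takes the value $1-r$ on $\emptyset$, $r f(\theta)$ on $\{\theta\}$, and $0$ on all other sets. **Assignments.** For integers $n,N\ge0$, $P_N^n$ is the set of all maps $\alpha:\{1,\dots,N\}\to\{0,\dots,n\}$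 such that $\{1,\dots,n\}\subseteq\alpha(\{1,\dots,N\})$ and, whenever $\alpha(i)>0$ and $i\ne l$, $\alpha(i)\neq\alpha(l)$. Given an enumeration $\mathbf{\Theta}^d=\{\theta_1,\dots,\theta_n\}$ with $n=|\mathbf{\Theta}^d|$, $\mathbf{\Theta}_{\alpha(i)}=\emptyset$ if $\alpha(i)=0$ and $\mathbf{\Theta}_{\alpha(i)}=\{\theta_{\alpha(i)}\}$ if $\alpha(i)>0$. **Measurement model.** The map is static. Given $\mathbf{\Theta}$, the measurement sets $\mathbf{Z}_1,\dots,\mathbf{Z}_K$ are independent. $\mathbf{Z}_k$ is the union of independent sets: clutter, a PPP with rate $\lambda_c$ and spatial density $c(\mathbf{z})$; and, for each landmark $\theta\in\mathbf{\Theta}$ independently, a set which is empty with probability $1-p_D^k(\theta)$ (not detected) and with probability $p_D^k(\theta)\in[0,1]$ (detected) is a PPP with rate $\gamma_k(\theta)\ge0$ and spatial density $\phi(\cdot\mid\theta)$. Equivalently, the probability generating functional of $\mathbf{Z}_k$ given $\mathbf{\Theta}$ is $$\exp\Big(\lambda_c\int c(\mathbf{z})g(\mathbf{z})d\mathbf{z}-\lambda_c\Big)\prod_{\theta\in\mathbf{\Theta}}\Big(1-p_D^k(\theta)+p_D^k(\theta)\exp\big(\gamma_k(\theta)\textstyle\int\phi(\mathbf{z}\mid\theta)g(\mathbf{z})d\mathbf{z}-\gamma_k(\theta)\big)\Big),$$ and the conditional set density is $$f_k(\mathbf{Z}_k\mid\mathbf{\Theta})=\sum e^{-\lambda_c}\prod_{\mathbf{z}\in\mathbf{Z}^c}\lambda_c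 c(\mathbf{z})\prod_{\theta\in\mathbf{\Theta}}\ell_k(\mathbf{Z}^\theta\mid\theta),$$ the sum running over all ways of writing $\mathbf{Z}_k$ as a disjoint union of possibly empty sets $\mathbf{Z}^c$ and $\mathbf{Z}^\theta$ ($\theta\in\mathbf{\Theta}$), with $\ell_k(\mathbf{V}\mid\theta)=p_D^k(\theta)e^{-\gamma_k(\theta)}\prod_{\mathbf{z}\in\mathbf{V}}\gamma_k(\theta)\phi(\mathbf{z}\mid\theta)$ for $\mathbf{V}\ne\emptyset$ and $\ell_k(\emptyset\mid\theta)=1-p_D^k(\theta)+p_D^k(\theta)e^{-\gamma_k(\theta)}$. **Posterior.** $f(\mathbf{\Theta}\mid\mathbf{Z})=\dfrac{f_0(\mathbf{\Theta})\prod_{k=1}^K f_k(\mathbf{Z}_k\mid\mathbf{\Theta})}{\int f_0(\mathbf{\Theta}')\prod_{k=1}^K f_k(\mathbf{Z}_k\mid\mathbf{\Theta}')\,\delta\mathbf{\Theta}'}$. **Conventions.** Measurements carry their time tag, so $\mathbf{Z}_1,\dots,\mathbf{Z}_K$ are treated as disjoint. All functions are measurable. The denominator of the posterior is assumed to be positive and finite. Whenever a normalizing denominator ($\langle f_0^u;\prod_k l_k^{j,i}\rangle$, $\langle f_0^u;\prod_k q_D^k\rangle$, or $\lambda_c c(\mathbf{z})+L_K^{j,i}$) vanishes, the corresponding ratio may be given an arbitrary value (an arbitrary density, respectively an arbitrary number in $[0,1]$); it is then multiplied by zero in the formula.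
   Formalization: The identity is proved for finite sets avoiding an explicit null set of states, where f_0^u times a likelihood product is nonzero though its integral vanishes (the pointwise formula can fail there); the reference measure is assumed to have no point masses, as the set integral requires. *)

(* Defs.v *)
From HB Require Import structures.
From mathcomp Require Import all_boot all_order all_algebra finmap.
From mathcomp Require Import all_classical all_reals all_analysis.

Set Implicit Arguments.
Unset Strict Implicit.
Unset Printing Implicit Defensive.

Import Order.TTheory GRing.Theory Num.Theory.
Import numFieldNormedType.Exports.

Local Open Scope fset_scope.
Local Open Scope ring_scope.

(* No constraint is put on the extent matrix: restricting it, for instance to
   symmetric positive definite matrices, is a matter of where the reference
   measure and the prior density live. *)
Record landmark (R : realType) := Landmark {
  position : 'rV[R]_2 ;
  extent : 'M[R]_2 ;
  expected_count : R ;
  expected_count_gt0 : 0 < expected_count }.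

Section landmark_structure.
Variable R : realType.

HB.instance Definition _ := gen_eqMixin (landmark R).
HB.instance Definition _ := gen_choiceMixin (landmark R).
HB.instance Definition _ :=
  isPointed.Build (landmark R) (Landmark 0 0 (@ltr01 R)).

Definition coordinates (x : landmark R) :
    (R * R) * ((R * R) * (R * R)) * R :=
  ((position x 0 0, position x 0 1),
   ((extent x 0 0, extent x 0 1), (extent x 1 0, extent x 1 1)),
   expected_count x).

HB.instance Definition _ :=
  Measurable.copy (landmark R) (g_sigma_algebra_preimageType coordinates).

End landmark_structure.

Section set_densities.
Variables (R : realType) (T : choiceType).
Implicit Types (X A : {fset T}) (f : T -> R).

Definition poisson_density (lam : R) f X : R :=
  expR (- lam) * \prod_(x <- X) (lam * f x).

Definition bernoulli_density (r : R) f X : R :=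
  match enum_fset X with
  | [::] => 1 - r
  | [:: x] => r * f x
  | _ => 0
  end.

(* The maps [{1..N} -> {0..n}] that are onto [{1..n}] and injective off the
   preimage of [0]; the domain [{1..N}] is shifted to ['I_N]. *)
Definition assignments (n N : nat) : {set {ffun 'I_N -> 'I_n.+1}} :=
  [set a : {ffun 'I_N -> 'I_n.+1} |
    [forall m : 'I_n.+1, (0 < m)%N ==> [exists i, a i == m]] &&
    [forall i, forall l, ((0 < a i)%N && (i != l)) ==> (a i != a l)]].

Definition assigned A (m : 'I_#|` A|.+1) : {fset T} :=
  if unlift ord0 m is Some m' then [fset tnth (in_tuple (enum_fset A)) m']
  else fset0.

End set_densities.

Definition bell (n : nat) : nat :=
  #|[set P : {set {set 'I_n}} | finset.partition P [set: 'I_n]%SET]|.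

Definition is_pdf (R : realType) (d : measure_display) (T : measurableType d)
    (mu : {measure set T -> \bar R}) (f : T -> R) : Prop :=
  [/\ measurable_fun [set: T] f, (forall x, 0 <= f x)
    & (\int[mu]_x (f x)%:E = 1)%E].

Section set_integral.
Variables (R : realType) (d : measure_display) (T : measurableType d).
Variable mu : {measure set T -> \bar R}.

(* [int g (x1 :: .. :: xn :: s) dx1 .. dxn], as an iterated integral. *)
Fixpoint iterated_integral (n : nat) (g : seq T -> \bar R) (s : seq T) : \bar R :=
  if n is n'.+1 then (\int[mu]_x iterated_integral n' g (x :: s))%E else g s.

(* [fset x in s] merges repeated points, so this is the set integral of the
   literature only when [mu] has no atoms. *)
Definition set_integral (tau : {fset T} -> R) : \bar R :=
  ((tau fset0)%:E + \sum_(1 <= n <oo) ((n`!%:R)^-1)%:E *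
    iterated_integral n (fun s => (tau [fset x in s])%:E) [::])%E.

Definition inner (f h : T -> R) : R := \int[mu]_x (f x * h x).

(* [g] is [f h / <f; h>], or an arbitrary density when this normalization is
   meaningless; [inner] takes the value [0] on infinite integrals as well. *)
Definition normalization (f h g : T -> R) : Prop :=
  if inner f h == 0 then is_pdf mu g
  else forall x, g x = f x * h x / inner f h.

Definition hidden_mass (f h : T -> R) : set T :=
  [set x | (\int[mu]_y (f y * h y)%:E = 0)%E /\ f x * h x != 0]%classic.

End set_integral.

Record slam_model (R : realType) (d : measure_display) (M : measurableType d)
    (mu : {measure set (landmark R) -> \bar R}) (nu : {measure set M -> \bar R})
    (K : nat) := SlamModel {
  prior_rate : R ;
  prior_pdf : landmark R -> R ;
  clutter_rate : R ;
  clutter_pdf : M -> R ;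
  detection : 'I_K -> landmark R -> R ;
  meas_rate : 'I_K -> landmark R -> R ;
  meas_pdf : M -> landmark R -> R ;
  prior_rate_ge0 : 0 <= prior_rate ;
  prior_pdfP : is_pdf mu prior_pdf ;
  clutter_rate_ge0 : 0 <= clutter_rate ;
  clutter_pdfP : is_pdf nu clutter_pdf ;
  detection_measurable : forall k, measurable_fun [set: landmark R] (detection k) ;
  detection01 : forall k x, 0 <= detection k x <= 1 ;
  meas_rate_measurable : forall k, measurable_fun [set: landmark R] (meas_rate k) ;
  meas_rate_ge0 : forall k x, 0 <= meas_rate k x ;
  meas_pdf_measurable :
    measurable_fun [set: M * landmark R] (fun u => meas_pdf u.1 u.2) ;
  meas_pdfP : forall x, is_pdf nu (meas_pdf ^~ x) }.

Section pmbm.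
Variables (R : realType) (d : measure_display) (M : measurableType d).
Variables (mu : {measure set (landmark R) -> \bar R}).
Variables (nu : {measure set M -> \bar R}) (K : nat).
Variable S : slam_model mu nu K.
Implicit Types (k : 'I_K) (x : landmark R) (X : {fset landmark R}).

Definition missed k x : R :=
  1 - detection S k x + detection S k x * expR (- meas_rate S k x).

Definition landmark_likelihood k (V : {fset M}) x : R :=
  if V == fset0 then missed k x
  else detection S k x * expR (- meas_rate S k x)
       * \prod_(z <- V) (meas_rate S k x * meas_pdf S z x).

(* A way of writing [Z] as a disjoint union of a clutter set, [V None], and one
   set [V (Some x)] for each landmark [x] of [X]. *)
Definition origin_split (Z : {fset M}) X
    (V : {ffun option X -> fpowerset Z}) : bool :=
  [forall o, forall o', (o != o') ==> fdisjoint (val (V o)) (val (V o'))]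
  && ((\bigcup_(o in {: option X}) val (V o))%fset == Z).

Definition measurement_density k (Z : {fset M}) X : R :=
  \sum_(V : {ffun option X -> fpowerset Z} | origin_split V)
    poisson_density (clutter_rate S) (clutter_pdf S) (val (V None))
    * \prod_(x : X) landmark_likelihood k (val (V (Some x))) (val x).

(* Batches of measurements are finite sets of pairs (time tag, measurement). *)
Definition at_time k (A : {fset 'I_K * M}) : {fset M} :=
  [fset u.2 | u in A & u.1 == k].

Variable Z : {fset 'I_K * M}.

Definition joint_density X : R :=
  poisson_density (prior_rate S) (prior_pdf S) X
  * \prod_(k < K) measurement_density k (at_time k Z) X.

Definition evidence : \bar R := set_integral mu joint_density.

Definition posterior X : R := joint_density X / fine evidence.

Definition undetected x : R := \prod_(k < K) missed k x.

Definition undetected_rate : R :=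
  prior_rate S * inner mu (prior_pdf S) undetected.

Implicit Types (C : {set Z}) (P : {set {set Z}}).

Definition cell_likelihood C x : R :=
  \prod_(k < K) landmark_likelihood k (at_time k [fsetval u in C]) x.

Definition detected_mass C : R :=
  prior_rate S * inner mu (prior_pdf S) (cell_likelihood C).

Definition cell_weight C : R :=
  if finset.unset1 C is Some u
  then clutter_rate S * clutter_pdf S (val u).2 + detected_mass C
  else detected_mass C.

Definition batch_partitions : {set {set {set Z}}} :=
  [set P : {set {set Z}} | finset.partition P [set: Z]%SET].

Definition partition_weight P : R :=
  (\prod_(C in P) cell_weight C)
  / \sum_(Q in batch_partitions) \prod_(C in Q) cell_weight C.

Definition existence_probability C (r : R) : Prop :=
  if finset.unset1 C is Some u then
    let total := clutter_rate S * clutter_pdf S (val u).2 + detected_mass C in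
    (total = 0 -> 0 <= r <= 1) /\ (total != 0 -> r = detected_mass C / total)
  else r = 1.

Definition pmbm_density (r : {set Z} -> R) (f : {set Z} -> landmark R -> R)
    (fu : landmark R -> R) X : R :=
  \sum_(D <- fpowerset X)
    (\sum_(P in batch_partitions) partition_weight P
      * \sum_(a in assignments #|` D| #|P|)
          \prod_(i < #|P|)
            bernoulli_density (r (enum_val i)) (f (enum_val i))
              (assigned (a i)))
    * poisson_density undetected_rate fu (X `\` D).

(* The landmark states at which the unnormalized density of a Bernoulli or of
   the Poisson component is nonzero although its integral vanishes. There the
   joint density depends on the chosen version of the model densities, whereas
   the parameters of the mixture do not; this set is empty as soon as all
   normalizers are nonzero. *)
Definition exceptional : set (landmark R) :=
  [set x | 0 < prior_rate S /\
    (hidden_mass mu (prior_pdf S) undetected x \/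
     exists2 C : {set Z}, C != finset.set0 &
       hidden_mass mu (prior_pdf S) (cell_likelihood C) x)]%classic.

End pmbm.

(* Main.v *)
(* Expanding the sums over the origins of the measurements, the joint density
   at X is, up to a constant, a sum over the maps h from the measurements to
   option X, where None stands for clutter.  The nonempty fibers over landmarks
   and the singletons of clutter measurements form a partition of Z, so this is
   a sum over the partitions of Z and over the labellings of their cells by
   None or by pairwise distinct landmarks, where only singletons have a nonzero
   weight for the label None.  Integrating the landmarks out, a cell C
   contributes clutter(C) + mass(C), and the undetected landmarks contribute an
   exponential series; the evidence is therefore a constant times
   sum_P prod_(C in P) (clutter(C) + mass(C)), and the quotient is the mixture
   term by term.  The masses may be infinite, hence the evidence is computed in
   the semiring of nonnegative extended reals; as it is finite, a partition
   with a cell of infinite mass also has a cell of weight zero, and its term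
   vanishes on both sides. *)
Require Import Defs.
From HB Require Import structures.
From mathcomp Require Import all_boot all_order all_algebra finmap.
From mathcomp Require Import all_classical all_reals all_analysis measurable_realfun ring.

Set Implicit Arguments.
Unset Strict Implicit.
Unset Printing Implicit Defensive.

Import Order.TTheory GRing.Theory Num.Theory.
Import numFieldNormedType.Exports.

Local Open Scope fset_scope.
Local Open Scope ring_scope.

(** * Splittings and partitions *)

Variant unset1_spec (T : finType) (C : {set T}) : option T -> Prop :=
  | Unset1Some z of C = [set z]%SET : unset1_spec C (Some z)
  | Unset1None of (forall z, C != [set z]%SET) : unset1_spec C None.

Lemma unset1P (T : finType) (C : {set T}) : unset1_spec C (finset.unset1 C).
Proof.
have := unset1K C; case E: (finset.unset1 C) => [z|] /= e; constructor => //.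
by move=> z; apply: contraPneq E => ->; rewrite set1K.
Qed.

Section splitting.
Variables (S : comPzSemiRingType) (T I : finType).
Variables (w0 : T -> S) (w : {set T} -> I -> S).
Implicit Types (h : {ffun T -> option I}) (P : {set {set T}}).
Implicit Types (C : {set T}) (b : {ffun {set T} -> option I}).

Definition fiber (h : T -> option I) (o : option I) : {set T} :=
  [set z | h z == o]%SET.

(* The label None marks a cell of clutter, which must be a singleton. *)
Definition block_weight (C : {set T}) (o : option I) : S :=
  if o is Some i then w C i
  else if finset.unset1 C is Some z then w0 z else 0.

(* The value None outside of P makes a labelling of P a unique finite function. *)
Definition labelling (P : {set {set T}}) (b : {ffun {set T} -> option I}) :=
  [forall C, (C \notin P) ==> (b C == None)] &&
  [forall C, forall C', (b C == b C') && (b C != None) ==> (C == C')].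

Local Notation pblock := finset.pblock.
Local Notation partition := finset.partition.

(** Points with the same landmark label share a key, hence a block. The second component keeps
    points labelled [None] apart, so that each of them forms a block of its own. *)
Let key h z := (h z, if h z is None then Some z else None).
Let part h : {set {set T}} := preim_partition (key h) [set: T]%SET.
(** The points of a block of [part h] all carry the same label, so the choice made by [pick] is
    immaterial. *)
Let lab h := [ffun C : {set T} => if C \in part h then
    (if [pick z in C] is Some z then h z else None) else None].
Let unlab (Pb : {set {set T}} * {ffun {set T} -> option I}) : {ffun T -> option I} :=
  [ffun z => Pb.2 (pblock Pb.1 z)].
(** The pairs of the form [(part h, lab h)]: among the blocks only singletons may be labelled
    [None]. *)
Let good (Pb : {set {set T}} * {ffun {set T} -> option I}) :=
  [&& partition Pb.1 [set: T]%SET, labelling Pb.1 Pb.2 &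
    [forall C in Pb.1, (Pb.2 C == None) ==> (finset.unset1 C != None)]].

Let pblock_memT P z : partition P [set: T]%SET -> pblock P z \in P.
Proof. by case/and3P => /eqP cov _ _; apply: pblock_mem; rewrite cov finset.in_setT. Qed.

Let mem_pblockT P z : partition P [set: T]%SET -> z \in pblock P z.
Proof. by case/and3P => /eqP cov _ _; rewrite mem_pblock cov finset.in_setT. Qed.

Let blockE P C z : partition P [set: T]%SET -> C \in P -> z \in C ->
  C = pblock P z.
Proof. by case/and3P => _ tr _ CP zC; rewrite (def_pblock tr CP zC). Qed.

Let block_ex P C : partition P [set: T]%SET -> C \in P -> exists z, z \in C.
Proof.
case/and3P => _ _ n0 CP; apply/finset.set0Pn; apply: contraNneq n0 => <-; exact: CP.
Qed.

Let eq_blockP P z y : partition P [set: T]%SET ->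
  (z \in pblock P y) = (pblock P z == pblock P y).
Proof.
move=> PT; apply/idP/eqP => [zy|<-]; last exact: mem_pblockT.
by apply/esym/blockE => //; exact: pblock_memT.
Qed.

Let partP h : partition (part h) [set: T]%SET.
Proof. exact: preim_partitionP. Qed.

Let eq_part h x y : (pblock (part h) x == pblock (part h) y) = (key h x == key h y).
Proof.
rewrite -eq_blockP // pblock_equivalence_partition ?finset.in_setT //.
  by move=> ? ? ? *; split => // /eqP->.
Qed.

Let lab_pblock h z : lab h (pblock (part h) z) = h z.
Proof.
rewrite ffunE pblock_memT //; case: pickP => [y|/(_ z)]; last by rewrite mem_pblockT.
by rewrite eq_blockP // eq_part => /eqP[].
Qed.

Let unlabK h : unlab (part h, lab h) = h.
Proof. by apply/ffunP => z; rewrite ffunE /= lab_pblock. Qed.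

Let good_lab h : good (part h, lab h).
Proof.
apply/and3P; split => /=; first exact: partP.
- apply/andP; split.
    by apply/forallP => C; apply/implyP => CP; rewrite ffunE (negbTE CP).
  apply/forallP => C; apply/forallP => C'; apply/implyP => /andP[/eqP e n0].
  have CP : C \in part h by apply: contraNT n0; rewrite ffunE => /negbTE->.
  have CP' : C' \in part h by apply: contraNT n0; rewrite e ffunE => /negbTE->.
  have [z zC] := block_ex (partP h) CP; have [z' zC'] := block_ex (partP h) CP'.
  move: e n0; rewrite (blockE (partP h) CP zC) (blockE (partP h) CP' zC') !lab_pblock.
  by rewrite eq_part /key => <-; case: (h z).
- apply/forallP => C; apply/implyP => CP; apply/implyP.
  have [z zC] := block_ex (partP h) CP.
  rewrite (blockE (partP h) CP zC) lab_pblock => /eqP hz.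
  suff -> : pblock (part h) z = [set z]%SET.
    by case: unset1P => // /(_ z); rewrite eqxx.
  apply/setP => y; rewrite eq_blockP // eq_part /key hz inE.
  apply/eqP/eqP => [[e]|->]; last by rewrite hz.
  by rewrite e => -[].
Qed.

Let key_unlab P b z y : good (P, b) ->
  (key (unlab (P, b)) z == key (unlab (P, b)) y) = (pblock P z == pblock P y).
Proof.
case/and3P => /= PT /andP[_ /forallP inj] /forallP sing.
rewrite /key !ffunE /=; apply/eqP/eqP => [[e]|eb].
  move: (inj (pblock P z)) => /forallP/(_ (pblock P y))/implyP; rewrite e eqxx /=.
  by case: (b (pblock P y)) => [i /(_ isT)/eqP|_ [->]].
rewrite eb; congr pair; case E: (b _) => //; congr Some.
move: (sing (pblock P y)); rewrite pblock_memT //= E eqxx /=.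
case: unset1P => // x /setP C1 _.
have := C1 y; rewrite mem_pblockT // inE => /esym/eqP ->.
by have := C1 z; rewrite eq_blockP // eb eqxx inE => /esym/eqP ->.
Qed.

Let part_unlab P b : good (P, b) -> part (unlab (P, b)) = P.
Proof.
move=> g; have /and3P[/= PT _ _] := g.
have e z : pblock (part (unlab (P, b))) z = pblock P z.
  by apply/setP => y; rewrite !eq_blockP // eq_part key_unlab.
apply/setP => C; apply/idP/idP => CP.
  have [z zC] := block_ex (partP _) CP.
  by rewrite (blockE (partP _) CP zC) e pblock_memT.
have [z zC] := block_ex PT CP.
by rewrite (blockE PT CP zC) -e pblock_memT.
Qed.

Let lab_unlab P b : good (P, b) -> lab (unlab (P, b)) = b.
Proof.
move=> g; have /and3P[/= PT /andP[/forallP supp _] _] := g.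
apply/ffunP => C; case: (boolP (C \in P)) => CP.
  have [z zC] := block_ex PT CP.
  have := lab_pblock (unlab (P, b)) z; rewrite part_unlab // (blockE PT CP zC) => ->.
  by rewrite ffunE.
by rewrite ffunE part_unlab // (negbTE CP); have := supp C; rewrite CP => /eqP.
Qed.

(** The map [h |-> (part h, lab h)] is a bijection onto the [good] pairs, with inverse [unlab]. Any
    other pair has a block labelled [None] that is not a singleton, and this block contributes a
    zero factor. A label carried by no block has an empty fiber, whence the last product. *)
Lemma sum_splittings_partition :
  \sum_(h : {ffun T -> option I})
     (\prod_(z | h z == None) w0 z) * \prod_i w (fiber h (Some i)) i =
  \sum_(P : {set {set T}} | finset.partition P [set: T]%SET)
    \sum_(b | labelling P b) (\prod_(C in P) block_weight C (b C))
        * \prod_(i | Some i \notin codom b) w finset.set0 i.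
Proof.
rewrite pair_big_dep /= (bigID good) /= [X in _ + X]big1 ?addr0; last first.
  move=> [P b] /= /andP[/andP[PT lb]]; rewrite /good PT lb /= negb_forall.
  case/existsP => C; rewrite negb_imply => /andP[CP].
  rewrite negb_imply negbK => /andP[/eqP bC /eqP C1].
  by rewrite (bigD1 C) //= bC /= C1 !mul0r.
rewrite (reindex_onto unlab (fun h => (part h, lab h))) /=; last first.
  by move=> h _; exact: unlabK.
apply: eq_big => [[P b]|[P b] /= /eqP e].
  apply/eqP/idP => [<-|/andP[_ g]]; last by rewrite part_unlab ?lab_unlab.
  by rewrite good_lab /=; have /and3P[/= -> -> _] := good_lab (unlab (P, b)).
have g : good (P, b) by rewrite -e; exact: good_lab.
have /and3P[/= PT /andP[/forallP supp /forallP inj] /forallP sing] := g.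
(* Injectivity of the labelling makes the block carrying the label [Some i] unique, so it is the
   whole fiber. *)
have fibS i C : C \in P -> b C = Some i -> fiber (unlab (P, b)) (Some i) = C.
  move=> CP bC; apply/setP => z; rewrite inE ffunE /=.
  apply/eqP/idP => [|zC]; last by rewrite -(blockE PT CP zC).
  move=> bz; move: (inj (pblock P z)) => /forallP/(_ C).
  by rewrite bz bC eqxx /= => /eqP <-; rewrite mem_pblockT.
rewrite (bigID (fun i => Some i \in codom b)) /= mulrA; congr (_ * _); last first.
  apply: eq_bigr => i ni; congr w; apply/setP => z; rewrite !inE ffunE /=.
  by apply/negP => /eqP bz; case/negP: ni; apply/codomP; exists (pblock P z); rewrite bz.
rewrite [RHS](bigID (fun C => b C == None)) /=; congr (_ * _).
  under [RHS]eq_bigr => C /andP[CP /eqP bC] do rewrite bC /=.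
  rewrite (partition_big (pblock P) (fun C => (C \in P) && (b C == None))) /=; last first.
    by move=> z; rewrite ffunE /= => ->; rewrite pblock_memT.
  apply: eq_bigr => C /andP[CP bC]; move: (sing C); rewrite CP bC /=.
  case: unset1P => // z C1 _; rewrite (big_pred1 z) // => y /=.
  rewrite ffunE /=; apply/andP/eqP => [[_ /eqP yC]|->].
    by have := mem_pblockT y PT; rewrite yC C1 inE => /eqP.
  by have zC : z \in C; [rewrite C1 inE|rewrite -(blockE PT CP zC)].
rewrite (partition_big b (fun o => isSome o && (o \in codom b))) /=; last first.
  by move=> C /andP[_]; rewrite codom_f; case: (b C).
rewrite [RHS](reindex_omap Some id) /=; last by case.
apply: eq_big => [i|i]; first by rewrite eqxx andbT.
move=> /codomP[C bC].
have CP : C \in P by have := supp C; rewrite -bC; case: (C \in P).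
rewrite (big_pred1 C) -?bC /= ?(fibS i C) // => C' /=.
apply/idP/eqP => [/andP[_ /eqP bC']|->]; last by rewrite CP -bC eqxx.
by move: (inj C') => /forallP/(_ C); rewrite bC' -bC eqxx => /eqP.
Qed.
End splitting.

(** * Labellings by landmarks as assignments to a subset of the landmarks *)

Section assignments_as_labellings.
Variables (S : comPzSemiRingType) (T : finType) (L : choiceType) (X : {fset L}).
Variables (V : {set T} -> {fset L} -> S) (u : L -> S).
Variable P : {set {set T}}.
Implicit Types (D : {fset L}) (b : {ffun {set T} -> option X}).

Definition fset_of_option (o : option X) : {fset L} :=
  if o is Some x then [fset val x] else fset0.

(** [dec] and [enc] translate between indices and labels: index [0] stands for [None], and index
    [m.+1] for the point at position [m] in the enumeration of [D]. *)
Let dec D (m : 'I_#|` D|.+1) : option X :=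
  if unlift ord0 m is Some m' then insub (tnth (in_tuple (enum_fset D)) m') else None.

Let enc D (o : option X) : 'I_#|` D|.+1 :=
  if o is Some x then inord (index (val x) (enum_fset D)).+1 else ord0.

Let dec0 D : dec (ord0 : 'I_#|` D|.+1) = None.
Proof. by rewrite /dec unlift_none. Qed.

Let decS D (m : 'I_#|` D|) : D `<=` X ->
  exists2 x : X, dec (lift ord0 m) = Some x & val x = tnth (in_tuple (enum_fset D)) m.
Proof.
move=> DX; rewrite /dec liftK.
have mX : tnth (in_tuple (enum_fset D)) m \in X.
  by apply: (fsubsetP DX); exact: mem_tnth.
by exists [` mX]; rewrite ?insubT.
Qed.

Let fset_dec D (m : 'I_#|` D|.+1) : D `<=` X -> fset_of_option (dec m) = assigned m.
Proof.
move=> DX; rewrite /assigned; case: unliftP => [m'|] ->; last by rewrite dec0.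
by have [x -> xE] := decS m' DX; rewrite /= xE.
Qed.

Let decK D (m : 'I_#|` D|.+1) : D `<=` X -> enc D (dec m) = m.
Proof.
move=> DX; case: (unliftP ord0 m) => [m'|] ->; last by rewrite dec0.
have [x -> /= ->] := decS m' DX.
by apply/val_inj; rewrite /= (tnth_nth (val x)) index_uniq ?fset_uniq // inordK // ltnS.
Qed.

Let encK D (o : option X) : D `<=` X ->
  (if o is Some x then val x \in D else true) -> dec (enc D o) = o.
Proof.
move=> DX; case: o => [x xD|_] /=; last by rewrite dec0.
have lt : (index (val x) (enum_fset D) < #|` D|)%N by rewrite index_mem.
have -> : inord (index (val x) (enum_fset D)).+1 = lift ord0 (Ordinal lt).
  by apply/val_inj; rewrite /= inordK.
have [y -> yE] := decS (Ordinal lt) DX; congr Some; apply/val_inj.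
by rewrite yE (tnth_nth (val x)) /= nth_index.
Qed.

Let used b := [fsetval x in [set x : X | Some x \in codom b]%SET].

Let usedP b (x : X) : (val x \in used b) = (Some x \in codom b).
Proof. by rewrite val_in_fset inE. Qed.

Let used_sub b : used b `<=` X.
Proof. by apply/fsubsetP => _ /imfsetP[x _ ->]; exact: valP. Qed.

Let lab D (a : {ffun 'I_#|P| -> 'I_#|` D|.+1}) : {ffun {set T} -> option X} :=
  [ffun C => if [pick i | enum_val i == C] is Some i then dec (a i) else None].

Let lab_enum D (a : {ffun 'I_#|P| -> 'I_#|` D|.+1}) i : lab a (enum_val i) = dec (a i).
Proof.
rewrite ffunE; case: pickP => [j /eqP/enum_val_inj->//|/(_ i)].
by rewrite eqxx.
Qed.

Let lab_notin D (a : {ffun 'I_#|P| -> 'I_#|` D|.+1}) C : C \notin P -> lab a C = None.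
Proof.
move=> CP; rewrite ffunE; case: pickP => // j /eqP jC; case/negP: CP.
by rewrite -jC; exact: enum_valP.
Qed.

Let enumP C : C \in P -> exists i : 'I_#|P|, C = enum_val i.
Proof. by move=> CP; exists (enum_rank_in CP C); rewrite enum_rankK_in. Qed.

Let codom_lab D (a : {ffun 'I_#|P| -> 'I_#|` D|.+1}) (x : X) :
  reflect (exists i, dec (a i) = Some x) (Some x \in codom (lab a)).
Proof.
apply/(iffP codomP) => [[C eC]|[i e]]; last by exists (enum_val i); rewrite lab_enum.
have CP : C \in P by apply: contraPT eC => /lab_notin->.
by have [i iC] := enumP CP; exists i; rewrite -lab_enum -iC.
Qed.

(** Reaching every nonzero index means that each point of [D] is used, and injectivity off index [0]
    is injectivity of the labelling off [None]. *)
Let labellingE D (a : {ffun 'I_#|P| -> 'I_#|` D|.+1}) : D `<=` X ->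
  labelling P (lab a) && (used (lab a) == D) = (a \in assignments #|` D| #|P|).
Proof.
move=> DX; have dec_inj := can_inj (fun m => decK m DX).
have pos (m : 'I_#|` D|.+1) : (0 < m)%N = (dec m != None).
  case: (unliftP ord0 m) => [m'|] ->; last by rewrite dec0.
  by have [x -> _] := decS m' DX.
rewrite inE andbC; congr (_ && _).
  apply/eqP/forallP => [uD m|H].
    apply/implyP; rewrite pos; case E: (dec m) => [x|] // _.
    have : Some x \in codom (lab a).
      rewrite -usedP uD; move: E; case: (unliftP ord0 m) => [m'|] ->; last by rewrite dec0.
      by have [y -> yE] := decS m' DX => -[<-]; rewrite yE; exact: mem_tnth.
    by case/codom_lab => i; rewrite -E => /dec_inj e; apply/existsP; exists i; apply/eqP.
  apply/fsetP => y; apply/idP/idP => [yu|yD].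
    have yX := fsubsetP (used_sub _) _ yu.
    move: yu; rewrite -[y]/(val [` yX]) usedP => /codom_lab[i].
    case: (unliftP ord0 (a i)) => [m'|] ->; last by rewrite dec0.
    by have [x -> xE] := decS m' DX => -[<-]; rewrite xE; exact: mem_tnth.
  have yX := fsubsetP DX _ yD; rewrite -[y]/(val [` yX]) usedP.
  have e : dec (enc D (Some [` yX])) = Some [` yX] by apply: encK.
  have := H (enc D (Some [` yX])); rewrite pos e => /= /existsP[i /eqP ai].
  by apply/codom_lab; exists i; rewrite ai.
apply/andP/forallP => [[_ /forallP inj] i|inj].
  apply/forallP => l; apply/implyP => /andP[ai il]; apply: contra il => /eqP e.
  have := inj (enum_val i) => /forallP/(_ (enum_val l)); rewrite !lab_enum e eqxx -e -pos ai.
  by move=> /eqP/enum_val_inj->.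
split; first by apply/forallP => C; apply/implyP => /lab_notin->.
apply/forallP => C; apply/forallP => C'; apply/implyP => /andP[/eqP e n0].
have CP : C \in P by apply: contraNT n0 => /lab_notin->.
have CP' : C' \in P by apply: contraNT n0; rewrite e => /lab_notin->.
have [i ?] := enumP CP; have [l ?] := enumP CP'; subst C C'.
move: e n0; rewrite !lab_enum => /dec_inj e; rewrite -pos => ai.
have := inj i => /forallP/(_ l); rewrite ai e eqxx /=.
by rewrite implybF negbK => /eqP->.
Qed.

Lemma sum_labellings_assignments :
  \sum_(b : {ffun {set T} -> option X} | labelling P b)
    (\prod_(C in P) V C (fset_of_option (b C)))
      * \prod_(x | Some x \notin codom b) u (val x) =
  \sum_(D <- fpowerset X)
    (\sum_(a in assignments #|` D| #|P|)
       \prod_(i < #|P|) V (enum_val i) (assigned (a i)))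
    * \prod_(x <- X `\` D) u x.
Proof.
have usedX b : used b \in fpowerset X by rewrite fpowersetE used_sub.
(* The subsets of [X] become a finite type, in which the used set of a labelling takes its
   values. *)
rewrite [RHS]big_seq_fsetE /=.
rewrite (partition_big (fun b => [` usedX b]) predT) //=.
apply: eq_bigr => -[D DX'] _ /=; have DX : D `<=` X by rewrite -fpowersetE.
rewrite big_distrl /=.
pose delab (b : {ffun {set T} -> option X}) : {ffun 'I_#|P| -> 'I_#|` D|.+1} :=
  [ffun i => enc D (b (enum_val i))].
rewrite (reindex_onto (@lab D) delab) /=; last first.
  move=> b /andP[/andP[/forallP supp _] /eqP[uD]].
  apply/ffunP => C; case: (boolP (C \in P)) => CP; last first.
    by rewrite lab_notin //; have := supp C; rewrite CP => /eqP.
  have [i ->] := enumP CP; rewrite lab_enum ffunE encK //.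
  by case E: (b _) => [x|] //; rewrite -uD usedP -E codom_f.
apply: eq_big => [a|a].
  rewrite -labellingE // -(inj_eq val_inj) /= [X in _ && X](_ : _ = true) ?andbT //.
  by apply/eqP/ffunP => i; rewrite ffunE lab_enum decK.
rewrite -(inj_eq val_inj) /= => /andP[/andP[la /eqP uD] _]; congr (_ * _).
  rewrite big_enum_val; apply: eq_bigr => i _.
  by rewrite lab_enum fset_dec.
rewrite (_ : \prod_(x <- X `\` D) u x = \prod_(x <- X | x \notin D) u x).
  by rewrite [RHS]big_seq_fsetE /=; apply: eq_bigl => x; rewrite -usedP uD.
rewrite -[RHS]big_filter; apply: perm_big; apply: uniq_perm => [||y].
- exact: fset_uniq.
- by rewrite filter_uniq // fset_uniq.
- by rewrite mem_filter in_fsetE.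
Qed.

End assignments_as_labellings.

(** * Summing labellings whose weights do not depend on the label *)

Section counting_labellings.
Variables (S : comPzSemiRingType) (T : finType) (w0 : T -> S) (m : {set T} -> S).
Variables (P : {set {set T}}) (m0 : S) (n : nat).
Implicit Types (A : {set {set T}}) (b : {ffun {set T} -> option 'I_n}).

Let supp b := [set C | b C != None]%SET.

(** A labelling with support [A] is an injection of [A] into the [n] labels, extended by [None]. *)
Lemma card_labellings A :
  A \subset P -> #|[set b | labelling P b && (supp b == A)]%SET| = (n ^_ #|A|)%N.
Proof.
move=> AP; pose U := {C : {set T} | C \in A}.
pose ext (f : {ffun U -> 'I_n}) : {ffun {set T} -> option 'I_n} :=
  [ffun C => omap f (insub C : option U)].
have extT f (c : U) : ext f (val c) = Some (f c) by rewrite ffunE valK.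
have extF f C : C \notin A -> ext f C = None by move=> CA; rewrite ffunE insubN.
have ext_inj : injective ext.
  by move=> f g /ffunP e; apply/ffunP => c; have := e (val c); rewrite !extT => -[].
rewrite -[n in RHS]card_ord -[#|A|]card_sig -card_inj_ffuns -(card_imset _ ext_inj).
apply: eq_card => b; rewrite inE; apply/idP/idP.
  move=> /andP[/andP[_ /forallP inj] /eqP sA].
  have sAC C : (C \in A) = (b C != None) by rewrite -sA inE.
  have bA (c : U) : {i : 'I_n | b (val c) = Some i}.
    have cA : val c \in A by exact: valP.
    by move: cA; rewrite sAC; case: (b _) => // i _; exists i.
  apply/imsetP; exists [ffun c => sval (bA c)].
    rewrite inE; apply/injectiveP => c c'; rewrite !ffunE.
    case: (bA c) (bA c') => i /= bi [j bj] /= ij; apply/val_inj/eqP.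
    by have := inj (val c) => /forallP/(_ (val c')); rewrite bi bj ij eqxx.
  apply/ffunP => C; case: (boolP (C \in A)) => CA.
    by rewrite -[C]/(val (exist _ C CA : U)) extT ffunE; case: (bA _).
  by rewrite extF //; move: CA; rewrite sAC negbK => /eqP.
case/imsetP => f; rewrite inE => /injectiveP inj ->; apply/andP; split.
  apply/andP; split.
    apply/forallP => C; apply/implyP => CP; rewrite extF //.
    by apply: contra CP; exact: (fintype.subsetP AP).
  apply/forallP => C; apply/forallP => C'; apply/implyP => /andP[/eqP e n0].
  have CA : C \in A by apply: contraNT n0 => /extF->.
  have CA' : C' \in A by apply: contraNT n0; rewrite e => /extF->.
  move: e; rewrite -[C]/(val (exist _ C CA : U)) -[C']/(val (exist _ C' CA' : U)) !extT.
  by case=> /inj ->.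
apply/eqP/setP => C; rewrite inE; case: (boolP (C \in A)) => CA.
  by rewrite -[C]/(val (exist _ C CA : U)) extT.
by rewrite extF.
Qed.

(** As [m] ignores the label, a term depends only on the set [A] of blocks that are not labelled
    [None], and [card_labellings] counts the terms with a given [A]. *)
Lemma sum_labellings_support :
  \sum_(b : {ffun {set T} -> option 'I_n} | labelling P b)
    (\prod_(C in P) block_weight w0 (fun C _ => m C) C (b C))
      * \prod_(i | Some i \notin codom b) m0 =
  \sum_(A in powerset P)
    ((\prod_(C in A) m C)
      * \prod_(C in P :\: A) (if finset.unset1 C is Some z then w0 z else 0))
      * (m0 ^+ (n - #|A|) *+ n ^_ #|A|).
Proof.
rewrite (partition_big supp (fun A => A \in powerset P)) /=; last first.
  move=> b /andP[/forallP s _]; rewrite powersetE; apply/fintype.subsetP => C.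
  by rewrite inE; apply: contraNT => CP; have := s C; rewrite CP.
apply: eq_bigr => A; rewrite powersetE => AP.
rewrite -card_labellings // -sumr_const big_distrr /= big_mkcond [RHS]big_mkcond /=.
apply: eq_bigr => b _; rewrite inE; case: ifPn => // /andP[/andP[_ /forallP inj] /eqP sA].
congr (_ * _).
  rewrite (big_setID A) /= (finset.setIidPr AP); congr (_ * _); apply: eq_bigr => C.
    by rewrite -sA inE; case: (b C).
  by rewrite -sA !inE; case: (b C).
(* The labelling maps [A] bijectively onto the labels in use, so [n - #|A|] labels are left over. *)
rewrite prodr_const; congr (_ ^+ _).
pose B := [set i | Some i \in codom b]%SET.
have -> : #|[pred i | Some i \notin codom b]| = #|(~: B)%SET|.
  by apply: eq_card => i; rewrite !inE.
rewrite cardsCs finset.setCK card_ord; congr (_ - _)%N.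
have bA : [set b C | C in A]%SET = [set Some i | i in B]%SET.
  apply/setP => o; apply/imsetP/imsetP => [[C]|[i]].
    rewrite -sA inE; case E: (b C) => [i|] // _ ->.
    by exists i => //; rewrite inE -E codom_f.
  by rewrite inE => /codomP[C iC] ->; exists C => //; rewrite -sA inE -iC.
rewrite -(card_imset _ (@Some_inj _)) -bA card_in_imset // => C C'.
rewrite -sA inE => n0 _ e; apply/eqP.
by have := inj C => /forallP/(_ C'); rewrite n0 e eqxx.
Qed.
End counting_labellings.

(** * Nonnegative extended reals *)

Section nonneg_ereal.
Variable R : realType.

(** On all of [\bar R] distributivity fails, because of opposite infinities. The nonnegative part is
    a commutative semiring, so the preceding identities hold there even for infinite weights. *)
Definition nneR := {x : \bar R | (0%:E <= x)%E}.
HB.instance Definition _ := Choice.on nneR.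

Implicit Types x y z : nneR.

Let nne0 : nneR := exist _ 0%E (lexx _).
Let nne1 : nneR := exist _ 1%E (@lee01 R).
Let add x y : nneR := exist _ (val x + val y)%E (adde_ge0 (valP x) (valP y)).
Let mul x y : nneR := exist _ (val x * val y)%E (mule_ge0 (valP x) (valP y)).

Fact nneR_addA : associative add.
Proof. by move=> x y z; apply/val_inj; rewrite /= addeA. Qed.
Fact nneR_addC : commutative add.
Proof. by move=> x y; apply/val_inj; rewrite /= addeC. Qed.
Fact nneR_add0 : left_id nne0 add.
Proof. by move=> x; apply/val_inj; rewrite /= add0e. Qed.
HB.instance Definition _ :=
  GRing.isNmodule.Build nneR nneR_addA nneR_addC nneR_add0.

Fact nneR_mulA : associative mul.
Proof. by move=> x y z; apply/val_inj; rewrite /= muleA. Qed.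
Fact nneR_mulC : commutative mul.
Proof. by move=> x y; apply/val_inj; rewrite /= muleC. Qed.
Fact nneR_mul1 : left_id nne1 mul.
Proof. by move=> x; apply/val_inj; rewrite /= mul1e. Qed.
Fact nneR_mulDl : left_distributive mul add.
Proof.
by move=> x y z; apply/val_inj; rewrite /= ge0_muleDl //; [exact: (valP x)|exact: (valP y)].
Qed.
Fact nneR_mul0 : left_zero nne0 mul.
Proof. by move=> x; apply/val_inj; rewrite /= mul0e. Qed.
HB.instance Definition _ := GRing.Nmodule_isComPzSemiRing.Build nneR
  nneR_mulA nneR_mulC nneR_mul1 nneR_mulDl nneR_mul0.

Lemma val_nne_sum (I : Type) (r : seq I) (Q : pred I) (F : I -> nneR) :
  val (\sum_(i <- r | Q i) F i) = (\sum_(i <- r | Q i) val (F i))%E.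
Proof. by elim/big_rec2: _ => // i _ y _ <-. Qed.

Lemma val_nne_prod (I : Type) (r : seq I) (Q : pred I) (F : I -> nneR) :
  val (\prod_(i <- r | Q i) F i) = (\prod_(i <- r | Q i) val (F i))%E.
Proof. by elim/big_rec2: _ => // i _ y _ <-. Qed.

Lemma val_nneX x n : val (x ^+ n) = (val x ^+ n)%E.
Proof. by elim: n => [|n IH]; rewrite ?expr0 // exprS expeS -IH. Qed.

Lemma val_nneMn x n : val (x *+ n) = (n%:R%:E * val x)%E.
Proof.
elim: n => [|n IH]; first by rewrite mulr0n mul0e.
by rewrite mulrS -natr1 EFinD ge0_muleDl ?lee_fin // mul1e addeC -IH.
Qed.

End nonneg_ereal.

(** * Iterated integrals for a nonatomic measure *)

Section iterated_integrals.
Variables (R : realType) (d : measure_display) (T : measurableType d).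
Variable mu : {measure set T -> \bar R}.
Hypothesis measurable_set1 : forall x : T, measurable [set x]%classic.
Hypothesis nonatomic : forall x : T, (mu [set x]%classic = 0)%E.

(** A finite set of points is null, and all its subsets are measurable, so the values of [f] there
    affect neither measurability nor the integral. This serves inner integrals, whose value is known
    only off the points already chosen. *)
Lemma integral_eq_off_seq (s : seq T) (f g : T -> \bar R) :
  measurable_fun [set: T]%classic g -> (forall x, x \notin s -> f x = g x) ->
  (\int[mu]_x f x = \int[mu]_x g x)%E.
Proof.
move=> mg fg.
have ms (A : set T) : (A `<=` [set` s])%classic -> measurable A.
  move=> As; apply: countable_measurable => //.
  apply: sub_countable (finite_set_countable (finite_seq s)).
  exact: subset_card_le.
have mf : measurable_fun [set: T]%classic f.
  move=> _ Y mY; rewrite setTI.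
  have -> : (f @^-1` Y = (f @^-1` Y `&` [set` s]) `|` ((g @^-1` Y) `\` [set` s]))%classic.
    apply/seteqP; split => x /=.
      move=> Yx; case: (boolP (x \in s)) => xs; [by left|right].
      by split; [rewrite -fg|exact/negP].
    by move=> [[]//|[Yx /negP xs]]; rewrite fg.
  apply: measurableU; first by apply: ms => x [].
  by apply: measurableD; [rewrite -[X in measurable X]setTI; exact: mg|exact: ms].
apply: ae_eq_integral => //; exists [set` s]%classic; split; first exact: ms.
- have -> : [set` s]%classic = (\big[setU/classical_sets.set0]_(x <- s) [set x])%classic.
    by rewrite -bigcup_seq; apply/seteqP; split => x /=;
      [exists x|move=> [y /= ys ->]].
  have mb : measurable (\big[setU/classical_sets.set0]_(x <- s) [set x])%classic.
    by apply: bigsetU_measurable.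
  apply/eqP; rewrite eq_le measure_ge0 andbT.
  elim: (s) => [|x r IH]; first by rewrite big_nil measure0.
  rewrite big_cons; apply: le_trans (measureU2 _ _ _) _ => //.
    exact: bigsetU_measurable.
  rewrite -[leRHS]add0e leeD // le_eqVlt; apply/orP; left; apply/eqP; exact: nonatomic.
- move=> x /= xs; apply: contrapT => /negP ns; apply: xs => _; exact: fg.
Qed.

(* The product formula is only required on sequences without repetition, since
   [fset x in s] merges repeated points. *)
Lemma iterated_integral_sum_prod (H : finType) (x0 : T) (c : H -> \bar R)
    (F : H -> nat -> T -> \bar R) (N : nat) (g : seq T -> \bar R) :
  (forall h, 0 <= c h)%E -> (forall h j x, 0 <= F h j x)%E ->
  (forall h j, measurable_fun [set: T]%classic (F h j)) ->
  (forall s, uniq s -> size s = N ->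
     g s = \sum_h c h * \prod_(j < N) F h j (nth x0 s j))%E ->
  iterated_integral mu N g [::] = (\sum_h c h * \prod_(j < N) \int[mu]_x F h j x)%E.
Proof.
move=> c0 F0 mF gE.
(* Generalization for the induction: the points of [s] are already fixed and [n] integrations
   remain. Each integration adds its point at the front, so the points of [s] end up at positions
   [n + j]. *)
suff H0 n s : (n + size s)%N = N -> uniq s -> iterated_integral mu n g s =
    (\sum_h c h * \prod_(j < n) \int[mu]_x F h j x
       * \prod_(j < size s) F h (n + j)%N (nth x0 s j))%E.
  rewrite H0 ?addn0 //; apply: eq_bigr => h _.
  by rewrite big_ord0 mule1.
elim: n s => [|n IH] s ns us /=.
  rewrite gE //; apply: eq_bigr => h _; rewrite big_ord0 mule1.
  by rewrite -ns.
have P0 h : (0 <= \prod_(j < n) \int[mu]_x F h j x)%E.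
  by apply: prode_ge0 => j _; apply: integral_ge0.
have Q0 h : (0 <= \prod_(j < size s) F h (n.+1 + j)%N (nth x0 s j))%E.
  by apply: prode_ge0.
pose k h := (c h * \prod_(j < n) \int[mu]_x F h j x *
  \prod_(j < size s) F h (n.+1 + j)%N (nth x0 s j))%E.
have k0 h : (0 <= k h)%E by rewrite !mule_ge0.
(* The induction hypothesis requires [x :: s] to be free of repetitions, so it gives the integrand
   only for [x] outside [s]. *)
rewrite (@integral_eq_off_seq s _ (fun x => \sum_h k h * F h n x)%E); first last.
- move=> x xs; rewrite IH //=; last by rewrite xs.
    apply: eq_bigr => h _; rewrite big_ord_recl /= addn0 /k.
    rewrite -!muleA; congr (_ * (_ * _))%E; rewrite muleC; congr (_ * _)%E.
    by apply: eq_bigr => j _; rewrite /= addnS.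
  by rewrite -ns addnS.
- by apply: emeasurable_sum => h; apply: measurable_funeM.
rewrite ge0_integral_sum //; first last.
- by move=> h x _; rewrite mule_ge0.
- by move=> h; apply: measurable_funeM.
apply: eq_bigr => h _; rewrite ge0_integralZl //.
by rewrite big_ord_recr /= /k -!muleA; congr (_ * (_ * _))%E; rewrite muleC.
Qed.

End iterated_integrals.

(** * Measurability of single landmark states *)

Lemma measurable_set1_prod d1 d2 (T1 : measurableType d1) (T2 : measurableType d2)
    (a : T1) (b : T2) :
  measurable [set a]%classic -> measurable [set b]%classic ->
  measurable [set (a, b)]%classic.
Proof.
move=> ma mb; have -> : ([set (a, b)] = [set a] `*` [set b])%classic.
  by apply/seteqP; split => -[x y] /= [-> ->].
exact: measurableX.
Qed.

(** The sigma-algebra is pulled back along [coordinates], which is injective; hence a singleton is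
    the preimage of a singleton of real coordinates. *)
Lemma measurable_landmark1 (R : realType) (x : landmark R) : measurable [set x]%classic.
Proof.
have inj : injective (@coordinates R).
  case=> [p e c cp] [p' e' c' cp'] [].
  rewrite /= => p0 p1 e00 e01 e10 e11 cc; subst c'.
  have {p0 p1}-> : p = p'.
    apply/rowP => j; have : (j == 0) || (j == 1) by case: j => [[|[|j]] ?].
    by case/orP => /eqP ->.
  have {e00 e01 e10 e11}-> : e = e'.
    apply/matrixP => i j; have : (j == 0) || (j == 1) by case: j => [[|[|j]] ?].
    have : (i == 0) || (i == 1) by case: i => [[|[|i]] ?].
    by move=> /orP[]/eqP -> /orP[]/eqP ->.
  by rewrite (bool_irrelevance cp cp').
exists [set coordinates x]%classic.
  by do ![apply: measurable_set1_prod | exact: measurable_set1].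
by rewrite setTI; apply/seteqP; split => y /= => [/inj|->].
Qed.

(** * The joint density *)

Section rearrangement.
Variables (R : realType) (d : measure_display) (M : measurableType d).
Variables (mu : {measure set (landmark R) -> \bar R}).
Variables (nu : {measure set M -> \bar R}) (K : nat).
Variables (S : slam_model mu nu K) (Z : {fset 'I_K * M}).

Lemma mem_at_time k (C : {set Z}) (u : Z) :
  (val u).1 = k -> ((val u).2 \in at_time k [fsetval u in C]) = (u \in C).
Proof.
move=> uk; apply/imfsetP/idP => /= [[v]|uC].
  rewrite !inE => /andP[/imfsetP[/= w wC ->] /eqP wk] e.
  by suff -> : u = w by []; apply/val_inj/pair_eqP; rewrite /= uk wk e !eqxx.
by exists (val u) => //; rewrite !inE uk eqxx andbT; exact: uC.
Qed.

Lemma at_timeP k (C : {set Z}) z :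
  reflect (exists2 u : Z, u \in C & val u = (k, z)) (z \in at_time k [fsetval u in C]).
Proof.
apply: (iffP idP) => [zC|[u uC uE]]; last first.
  by have := @mem_at_time k C u; rewrite uE /= => ->.
case/imfsetP: zC => /= v; rewrite !inE => /andP[/imfsetP[/= u uC ->] /eqP uk] ->.
by exists u => //; rewrite -uk -surjective_pairing.
Qed.

(** Among measurements with a common time tag, forgetting the tag is injective, so no factor is
    lost. *)
Lemma prod_at_time k (C : {set Z}) (f : M -> R) :
  \prod_(z <- at_time k [fsetval u in C]) f z =
  \prod_(u | (u \in C) && ((val u).1 == k)) f (val u).2.
Proof.
rewrite -[RHS]big_filter.
pose r := [seq u : Z <- index_enum Z | (u \in C) && ((val u).1 == k)].
transitivity (\prod_(z <- [seq (val u).2 | u <- r]) f z); last by rewrite big_map.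
apply/perm_big/uniq_perm => [||z]; first exact: fset_uniq.
- rewrite map_inj_in_uniq ?filter_uniq ?index_enum_uniq // => u v.
  rewrite !mem_filter => /andP[/andP[_ /eqP uk] _] /andP[/andP[_ /eqP vk] _] e.
  by apply/val_inj/pair_eqP; rewrite /= uk vk e !eqxx.
- apply/at_timeP/mapP => [[u uC uE]|[u]].
    by exists u; rewrite ?mem_filter ?uC ?uE ?eqxx ?mem_index_enum.
  rewrite mem_filter => /andP[/andP[uC /eqP uk] _] ->; exists u => //.
  by rewrite -uk -surjective_pairing.
Qed.

Definition clutter_weight (u : Z) : R := clutter_rate S * clutter_pdf S (val u).2.

Definition split_factor k (I : finType) (x : I -> landmark R) (h : {ffun Z -> option I}) : R :=
  expR (- clutter_rate S)
  * \prod_(u | (h u == None) && ((val u).1 == k)) clutter_weight u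
  * \prod_i landmark_likelihood S k (at_time k [fsetval u in fiber h (Some i)]) (x i).

(** An origin split sends each measurement with tag [k] to the unique origin whose set contains it.
    Fixing the value [None] at the other tags makes the map [h] unique. *)
Lemma measurement_density_splittings k (X : {fset landmark R}) :
  measurement_density S k (at_time k Z) X =
  \sum_(h : {ffun Z -> option X} | [forall u, ((val u).1 != k) ==> (h u == None)])
    split_factor k val h.
Proof.
have sub (C : {set Z}) : at_time k [fsetval u in C] \in fpowerset (at_time k Z).
  rewrite fpowersetE; apply/fsubsetP => z /at_timeP[u _ uE].
  apply/imfsetP; exists (val u); last by rewrite uE.
  by rewrite inE uE eqxx andbT -uE; exact: valP.
pose Vof (h : {ffun Z -> option X}) : {ffun option X -> fpowerset (at_time k Z)} :=
  [ffun o => [` sub (fiber h o)]].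
(* For an origin split the sets cover all measurements of time [k], so there the default of [odflt]
   is never reached. *)
pose hof (V : {ffun option X -> fpowerset (at_time k Z)}) : {ffun Z -> option X} :=
  [ffun u => if (val u).1 == k then odflt None [pick o | (val u).2 \in val (V o)] else None].
have hV V u o : origin_split V -> (val u).1 = k -> (hof V u == o) = ((val u).2 \in val (V o)).
  case/andP => /forallP dis /eqP cov uk; rewrite ffunE uk eqxx.
  case: pickP => [p up|none] /=.
    apply/eqP/idP => [<-//|uo]; apply/eqP; apply: contraTT uo => neq.
    have := dis p => /forallP/(_ o); rewrite neq => /fdisjointP; exact.
  have : (val u).2 \in (\bigcup_(o in {: option X}) val (V o))%fset.
    by rewrite cov; apply/imfsetP; exists (val u); rewrite // inE uk eqxx andbT; exact: valP.
  by case/bigfcupP => p _; rewrite none.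
have VK V : origin_split V -> Vof (hof V) = V.
  move=> sV; apply/ffunP => o; apply/val_inj; rewrite ffunE /=.
  apply/fsetP => z; apply/at_timeP/idP => [[u]|zV].
    by rewrite inE => /[swap] uE; rewrite hV ?uE.
  have : z \in at_time k Z by move: (valP (V o)); rewrite fpowersetE => /fsubsetP; exact.
  rewrite /at_time => /imfsetP[/= v]; rewrite inE => /andP[vZ /eqP vk] zE.
  have e : v = (k, z) by rewrite -vk zE -surjective_pairing.
  by exists [` vZ] => //; rewrite inE hV //= -zE.
rewrite /measurement_density (reindex_onto Vof hof) //=.
have memV h u o : (val u).1 = k -> ((val u).2 \in val (Vof h o)) = (h u == o).
  by move=> uk; rewrite ffunE /= mem_at_time // inE.
have sV h : origin_split (Vof h).
  apply/andP; split.
    apply/forallP => o; apply/forallP => o'; apply/implyP => neq; apply/fdisjointP => z.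
    rewrite !ffunE /= => /at_timeP[u]; rewrite inE => /eqP ho uE.
    apply/negP => /at_timeP[v]; rewrite inE => /eqP ho' vE; case/eqP: neq.
    by rewrite -ho -ho'; congr (h _); apply/val_inj; rewrite uE vE.
  apply/eqP/fsetP => z; apply/bigfcupP/idP => [[p _]|].
    by rewrite ffunE /=; apply/fsubsetP; rewrite -fpowersetE sub.
  rewrite /at_time => /imfsetP[/= v]; rewrite inE => /andP[vZ /eqP vk] ->.
  have := memV h [` vZ] (h [` vZ]) vk; rewrite eqxx => mh.
  by exists (h [` vZ]); rewrite ?mem_index_enum.
apply: eq_big => [h|h _].
  rewrite sV /=; apply/eqP/forallP => [<- u|H].
    by apply/implyP => /negbTE uk; rewrite ffunE uk.
  apply/ffunP => u; case: (eqVneq (val u).1 k) => uk.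
    by apply/eqP; rewrite hV // memV.
  by have := H u; rewrite uk => /eqP ->; rewrite ffunE (negbTE uk).
rewrite /split_factor /poisson_density; congr (_ * _ * _).
  rewrite ffunE /= prod_at_time; apply: eq_bigl => u.
  by rewrite inE.
by apply: eq_bigr => x _; rewrite ffunE.
Qed.

(** Distributing the product over times gives a sum over families of maps, one for each [k] and
    equal to [None] off tag [k]. Such a family glues to a single map on [Z], and exchanging the
    products over times and landmarks collects the cell likelihoods. *)
Lemma joint_density_splittings (X : {fset landmark R}) :
  joint_density S Z X =
  expR (- prior_rate S) * expR (- clutter_rate S) ^+ K *
  \sum_(h : {ffun Z -> option X}) (\prod_(u | h u == None) clutter_weight u)
    * \prod_x (prior_rate S * prior_pdf S (val x)
               * cell_likelihood S (fiber h (Some x)) (val x)).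
Proof.
rewrite /joint_density /poisson_density -!mulrA; congr (_ * _).
rewrite (eq_bigr _ (fun k _ => measurement_density_splittings k X)).
rewrite bigA_distr_big_dep /=.
pose Hof (h : {ffun Z -> option X}) : {ffun 'I_K -> {ffun Z -> option X}} :=
  [ffun k => [ffun u => if (val u).1 == k then h u else None]].
pose hof (H : {ffun 'I_K -> {ffun Z -> option X}}) : {ffun Z -> option X} :=
  [ffun u => H (val u).1 u].
rewrite (reindex_onto Hof hof) /=; last first.
  move=> H /familyP Hk; apply/ffunP => k; apply/ffunP => u; rewrite !ffunE.
  case: eqVneq => [->//|uk]; have := Hk k => /forallP/(_ u).
  by rewrite uk => /eqP.
rewrite [LHS]mulr_sumr [RHS]mulr_sumr; apply: eq_big => [h|h _].
  apply/andP; split; last by apply/eqP/ffunP => u; rewrite !ffunE eqxx.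
  apply/familyP => k; apply/forallP => u; apply/implyP => /negbTE uk.
  by rewrite !ffunE uk.
have atH k o : at_time k [fsetval u in fiber (Hof h k) o] = at_time k [fsetval u in fiber h o].
  apply/fsetP => z; apply/at_timeP/at_timeP => -[u]; rewrite inE => ho uE;
  by exists u; rewrite // inE; move: ho; rewrite !ffunE uE eqxx.
under eq_bigr => k _ do rewrite /split_factor.
(* Naming the prior product shields it from the following [big_split]. *)
set Q := \prod_(x <- X) _; rewrite big_split /= big_split /= prodr_const card_ord {}/Q.
rewrite mulrCA -!mulrA; congr (_ * (_ * _)).
  rewrite [RHS](partition_big (fun u : Z => (val u).1) xpredT) //=.
  apply: eq_bigr => k _; apply: eq_bigl => u; rewrite !ffunE.
  by case: (eqVneq (val u).1 k) => _; rewrite ?andbT ?andbF.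
rewrite [RHS]big_split big_seq_fsetE /=; congr (_ * _).
rewrite exchange_big /=; apply: eq_bigr => x _; rewrite /cell_likelihood.
by apply: eq_bigr => k _; rewrite atH.
Qed.

End rearrangement.

(** * The evidence *)

Section exponential_series.
Variable R : realType.

Lemma nneseries_exp (x : R) : 0 <= x ->
  (\sum_(0 <= i <oo) (x ^+ i / i`!%:R)%:E = (expR x)%:E)%E.
Proof.
move=> x0; rewrite /expR -EFin_lim; last exact: is_cvg_series_exp_coeff.
by apply: congr_lim; apply/funext => n; rewrite /= /series /= -sumEFin.
Qed.

(** The terms with [n < j] vanish, and from [j] on the ratio of falling factorial to factorial is
    the inverse of the factorial of [n - j], which leaves a shifted exponential series. *)
Lemma nneseries_ffact_exp (x : R) (j : nat) : 0 <= x ->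
  (\sum_(0 <= n <oo) (x ^+ (n - j) * (n ^_ j)%:R / n`!%:R)%:E = (expR x)%:E)%E.
Proof.
move=> x0; have ge0 n : (0 <= (x ^+ (n - j) * (n ^_ j)%:R / n`!%:R)%:E)%E.
  by rewrite lee_fin !mulr_ge0 ?invr_ge0 ?exprn_ge0.
rewrite (nneseries_split 0 j) // add0n big_nat big1 ?add0e; last first.
  by move=> n /andP[_ nj]; rewrite ffact_small // mulr0 mul0r.
rewrite -nneseries_addn // -nneseries_exp //; apply: eq_eseriesr => n _.
congr EFin; rewrite addnK -mulrA; congr (_ * _).
have <- := @ffact_fact (n + j) j (leq_addl _ _).
rewrite addnK natrM invfM mulrA divff ?mul1r // pnatr_eq0 -lt0n ffact_gt0.
exact: leq_addl.
Qed.

(** For [B] infinite, the positive term [u k] makes both sides equal to [+oo]. *)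
Lemma ge0_nneseriesZl (B : \bar R) (u : nat -> R) (k : nat) :
  (0 <= B)%E -> (forall n, 0 <= u n) -> 0 < u k ->
  (\sum_(0 <= n <oo) (B * (u n)%:E) = B * \sum_(0 <= n <oo) (u n)%:E)%E.
Proof.
move=> B0 u0 uk.
case: B B0 => [b b0|_|//]; first by rewrite nneseriesZl // => i _; rewrite lee_fin.
rewrite [LHS](@nneseries_pinfty _ _ _ k) //.
- rewrite gt0_mulye //; apply: (@lt_le_trans _ _ (u k)%:E%E); first by rewrite lte_fin.
  apply: le_trans (nneseries_lim_ge k.+1 _); last by move=> *; rewrite lee_fin.
  rewrite big_nat_recr //=; apply: leeDr; apply: sume_ge0 => i _.
  by rewrite lee_fin.
- by move=> n _; apply: mule_ge0 => //; rewrite lee_fin.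
- by rewrite gt0_mulye // lte_fin.
Qed.

End exponential_series.

(** * Bounds, measurability and integrals of the likelihoods *)

Section model_functions.
Variables (R : realType) (d : measure_display) (M : measurableType d).
Variables (mu : {measure set (landmark R) -> \bar R}).
Variables (nu : {measure set M -> \bar R}) (K : nat).
Variables (S : slam_model mu nu K) (Z : {fset 'I_K * M}).
Implicit Types (C : {set Z}) (P : {set {set Z}}) (x : landmark R).

Lemma missed_itv k x : 0 <= missed S k x <= 1.
Proof.
have /andP[p0 p1] := detection01 S k x; have g0 := meas_rate_ge0 S k x.
rewrite /missed addr_ge0 ?subr_ge0 ?mulr_ge0 ?expR_ge0 //=.
by rewrite -lerBrDl opprB addrCA subrr addr0 ler_piMr // -expR0 ler_expR oppr_le0.
Qed.

Lemma landmark_likelihood_ge0 k V x : 0 <= landmark_likelihood S k V x.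
Proof.
rewrite /landmark_likelihood; case: ifP => _; first by case/andP: (missed_itv k x).
have /andP[p0 _] := detection01 S k x.
rewrite !mulr_ge0 ?expR_ge0 // prodr_ge0 // => z _.
rewrite mulr_ge0 ?(meas_rate_ge0 S) //.
by have [_ f0 _] := meas_pdfP S x; exact: f0.
Qed.

Lemma cell_likelihood_ge0 C x : 0 <= cell_likelihood S C x.
Proof. by apply: prodr_ge0 => k _; exact: landmark_likelihood_ge0. Qed.

(** A landmark that is never detected behaves as one with an empty cell, which lets both kinds be
    integrated out together. *)
Lemma cell_likelihood0 x : cell_likelihood S (finset.set0 : {set Z}) x = undetected S x.
Proof.
apply: eq_bigr => k _; rewrite /landmark_likelihood ifT //.
by apply/eqP/fsetP => z; apply/at_timeP; rewrite inE => -[u]; rewrite inE.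
Qed.

Lemma undetected_itv x : 0 <= undetected S x <= 1.
Proof.
apply/andP; split; last by apply: numdomain.Num.Theory.prodr_ile1 => k _; exact: missed_itv.
by apply: prodr_ge0 => k _; have /andP[] := missed_itv k x.
Qed.

Lemma measurable_missed k : measurable_fun [set: landmark R]%classic (missed S k).
Proof.
have mp := detection_measurable S k; have mg := meas_rate_measurable S k.
apply: measurable_funD; first by apply: measurable_funB.
apply: measurable_funM => //; apply: measurableT_comp; first exact: measurable_expR.
by apply: measurableT_comp => //; exact: oppr_measurable.
Qed.

Lemma measurable_landmark_likelihood k V :
  measurable_fun [set: landmark R]%classic (landmark_likelihood S k V).
Proof.
unfold landmark_likelihood; case: (V == fset0); first exact: measurable_missed.
have mp := detection_measurable S k; have mg := meas_rate_measurable S k.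
apply: measurable_funM.
  apply: measurable_funM => //; apply: measurableT_comp; first exact: measurable_expR.
  by apply: measurableT_comp => //; exact: oppr_measurable.
apply: measurable_prod => z _; apply: measurable_funM => //.
apply: (measurableT_comp (f := fun u => meas_pdf S u.1 u.2) (g := fun x => (z, x))).
  exact: meas_pdf_measurable.
exact: measurable_pair1.
Qed.

Lemma measurable_cell_likelihood C :
  measurable_fun [set: landmark R]%classic (cell_likelihood S C).
Proof. by apply: measurable_prod => k _; exact: measurable_landmark_likelihood. Qed.

Lemma measurable_undetected : measurable_fun [set: landmark R]%classic (undetected S).
Proof. by apply: measurable_prod => k _; exact: measurable_missed. Qed.

Lemma clutter_weight_ge0 (u : Z) : 0 <= clutter_weight S u.
Proof.
rewrite mulr_ge0 ?clutter_rate_ge0 //.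
by have [_ f0 _] := clutter_pdfP S; exact: f0.
Qed.

Lemma prior_pdf_ge0 x : 0 <= prior_pdf S x.
Proof. by have [_ f0 _] := prior_pdfP S; exact: f0. Qed.

Lemma measurable_prior_pdf : measurable_fun [set: landmark R]%classic (prior_pdf S).
Proof. by have [mf _ _] := prior_pdfP S. Qed.

(** The extended-real version of [detected_mass]: it keeps an infinite integral, which [inner]
    replaces by [0]. *)
Definition cell_mass C : \bar R :=
  ((prior_rate S)%:E * \int[mu]_x (prior_pdf S x * cell_likelihood S C x)%:E)%E.

Lemma cell_mass_ge0 C : (0 <= cell_mass C)%E.
Proof.
apply: mule_ge0; first by rewrite lee_fin prior_rate_ge0.
apply: integral_ge0 => x _.
by rewrite lee_fin mulr_ge0 ?prior_pdf_ge0 ?cell_likelihood_ge0.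
Qed.

Lemma fine_cell_mass C : fine (cell_mass C) = detected_mass S C.
Proof.
rewrite /cell_mass /detected_mass /inner /Rintegral.
have : (0 <= \int[mu]_x (prior_pdf S x * cell_likelihood S C x)%:E)%E.
  apply: integral_ge0 => x _.
  by rewrite lee_fin mulr_ge0 ?prior_pdf_ge0 ?cell_likelihood_ge0.
case: (\int[mu]_x _)%E => [r|_|//]; first by [].
(* The integral is infinite here. The mass is then [0] or [+oo] according to the prior rate, and
   [fine] sends both to [0]. *)
rewrite /= mulr0; have := prior_rate_ge0 S; rewrite le_eqVlt => /orP[/eqP <-|l0].
  by rewrite mul0e.
by rewrite gt0_muley ?lte_fin.
Qed.

(** The probability of remaining undetected is at most one and the prior density integrates to one.
    Hence the mass of the empty cell is always finite. *)
Lemma integral_prior_undetected_le1 :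
  (0 <= \int[mu]_x (prior_pdf S x * undetected S x)%:E <= 1)%E.
Proof.
have q01 := undetected_itv; apply/andP; split.
  apply: integral_ge0 => x _; rewrite lee_fin mulr_ge0 ?prior_pdf_ge0 //.
  by case/andP: (q01 x).
have [mf f0 <-] := prior_pdfP S; apply: ge0_le_integral => //.
- by move=> x _; rewrite lee_fin mulr_ge0 //; case/andP: (q01 x).
- apply/measurable_EFinP; apply: measurable_funM => //; exact: measurable_undetected.
- exact/measurable_EFinP.
- by move=> x _; rewrite lee_fin ler_piMr //; case/andP: (q01 x).
Qed.

Lemma cell_mass0 : cell_mass finset.set0 = (undetected_rate S)%:E.
Proof.
rewrite -[cell_mass _]fineK.
  rewrite fine_cell_mass /detected_mass /undetected_rate; congr ((_ * _)%:E).
  by congr inner; apply/funext => x; rewrite cell_likelihood0.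
rewrite /cell_mass; under eq_integral do rewrite cell_likelihood0.
have /andP[i0 i1] := integral_prior_undetected_le1.
by rewrite fin_numM // ge0_fin_numE // (le_lt_trans i1) // ltry.
Qed.

Lemma undetected_rate_ge0 : 0 <= undetected_rate S.
Proof.
rewrite mulr_ge0 ?prior_rate_ge0 // fine_ge0 //.
by case/andP: integral_prior_undetected_le1.
Qed.

End model_functions.

(** * Expanding a product of sums and renaming labels *)

Section splitting_tools.
Variable S : comPzSemiRingType.

Lemma prodrD_powerset (T : finType) (P : {set T}) (F G : T -> S) :
  \prod_(C in P) (F C + G C) =
  \sum_(A in powerset P) (\prod_(C in A) F C) * \prod_(C in P :\: A) G C.
Proof.
(* Outside [P] the factor [1] is written as [0 + 1], so that a subset not contained in [P]
   contributes zero. *)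
rewrite big_mkcond /= (eq_bigr (fun C => (if C \in P then F C else 0)
                                  + (if C \in P then G C else 1))); last first.
  by move=> C _; case: ifP; rewrite ?add0r.
rewrite bigA_distr (bigID (fun A => A \in powerset P)) /= [X in _ + X]big1 ?addr0.
  apply: eq_bigr => A; rewrite powersetE => AP; rewrite (bigID (mem A)) /=; congr (_ * _).
    by apply: eq_bigr => C CA; rewrite CA (fintype.subsetP AP).
  rewrite big_mkcond [RHS]big_mkcond; apply: eq_bigr => C _; rewrite inE.
  by case: (C \in A) => //=; case: ifP.
move=> A; rewrite powersetE => /subsetPn[C CA CP].
by rewrite (bigD1 C) //= CA (negbTE CP) mul0r.
Qed.

Lemma sum_splittings_reindex (T I J : finType) (w0 : T -> S) (w : {set T} -> J -> S)
    (phi : I -> J) : bijective phi ->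
  \sum_(h : {ffun T -> option J})
     (\prod_(z | h z == None) w0 z) * \prod_j w (fiber h (Some j)) j =
  \sum_(h : {ffun T -> option I})
     (\prod_(z | h z == None) w0 z) * \prod_i w (fiber h (Some i)) (phi i).
Proof.
case=> psi phiK psiK.
have bij (U V : finType) (f : U -> V) (g : V -> U) : cancel f g ->
    cancel (fun h : {ffun T -> option U} => [ffun z => omap f (h z)])
           (fun h : {ffun T -> option V} => [ffun z => omap g (h z)]).
  by move=> fK h; apply/ffunP => z; rewrite !ffunE; case: (h z) => //= x; rewrite fK.
rewrite (reindex (fun h : {ffun T -> option I} => [ffun z => omap phi (h z)])) /=; last first.
  by apply: onW_bij; eexists; [exact: (bij _ _ _ _ phiK)|exact: (bij _ _ _ _ psiK)].
apply: eq_bigr => h _; congr (_ * _).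
  by apply: eq_bigl => z; rewrite ffunE; case: (h z).
rewrite (reindex phi); last by apply: onW_bij; exists psi.
apply: eq_bigr => i _; congr w; apply/setP => z; rewrite !inE ffunE.
case: (h z) => //= j; exact: (inj_eq (inj_comp (@Some_inj _) (can_inj phiK))).
Qed.

End splitting_tools.

(** * The evidence as a sum over partitions *)

Section evidence.
Variables (R : realType) (d : measure_display) (M : measurableType d).
Variables (mu : {measure set (landmark R) -> \bar R}).
Variables (nu : {measure set M -> \bar R}) (K : nat).
Variables (S : slam_model mu nu K) (Z : {fset 'I_K * M}).
Implicit Types (C : {set Z}) (P : {set {set Z}}) (x : landmark R).

(** The joint density at the empty map when there are no measurements. *)
Definition empty_factor : R := expR (- prior_rate S) * expR (- clutter_rate S) ^+ K.

Lemma empty_factor_gt0 : 0 < empty_factor.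
Proof. by rewrite mulr_gt0 ?exprn_gt0 ?expR_gt0. Qed.

Definition cell_clutter C : R :=
  if finset.unset1 C is Some z then clutter_weight S z else 0.

Lemma cell_clutter_ge0 C : 0 <= cell_clutter C.
Proof. by rewrite /cell_clutter; case: finset.unset1 => // z; exact: clutter_weight_ge0. Qed.

(** Without repetitions, positions in [s] correspond bijectively to the points of the set, so
    splittings may be labelled by positions. *)
Lemma joint_density_seq (x0 : landmark R) (s : seq (landmark R)) : uniq s ->
  joint_density S Z [fset x in s] =
  empty_factor * \sum_(h : {ffun Z -> option 'I_(size s)})
    (\prod_(u | h u == None) clutter_weight S u)
    * \prod_(i < size s) (prior_rate S * prior_pdf S (nth x0 s i)
               * cell_likelihood S (fiber h (Some i)) (nth x0 s i)).
Proof.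
move=> us; rewrite joint_density_splittings; congr (_ * _).
have sX (i : 'I_(size s)) : nth x0 s i \in [fset x in s] by rewrite inE mem_nth.
pose phi (i : 'I_(size s)) : [fset x in s] := [` sX i].
rewrite (@sum_splittings_reindex _ _ _ _ (@clutter_weight _ _ _ _ _ _ S Z)
  (fun C (y : [fset x in s]) => prior_rate S * prior_pdf S (val y)
     * cell_likelihood S C (val y)) phi) //.
apply: inj_card_bij => [i j /(congr1 val)/= /eqP|].
  by rewrite nth_uniq // => /eqP/val_inj.
by rewrite -cardfE card_fseq undup_id // card_ord.
Qed.

(* The iterated integral runs over sequences, hence labels in nat instead of
   'I_n. *)
Let nat_fiber n (h : {ffun Z -> option 'I_n}) (j : nat) : {set Z} :=
  [set z | omap val (h z) == Some j]%SET.

Let nat_fiberE n (h : {ffun Z -> option 'I_n}) (i : 'I_n) :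
  nat_fiber h i = fiber h (Some i).
Proof.
by apply/setP => z; rewrite !inE; case: (h z).
Qed.

Let clutterN (z : Z) : nneR R := exist _ (clutter_weight S z)%:E (clutter_weight_ge0 S z).
Let massN C : nneR R := exist _ (cell_mass S C) (cell_mass_ge0 S C).

Hypothesis mu_nonatomic : forall x : landmark R, (mu [set x]%classic = 0)%E.

(** For a fixed splitting the integrand is a product of functions of one landmark each, and
    integrating a landmark out turns its factor into the mass of its fiber. *)
Lemma iterated_integral_joint_density n :
  iterated_integral mu n (fun s => (joint_density S Z [fset x in s])%:E) [::] =
  (empty_factor%:E * val (\sum_(h : {ffun Z -> option 'I_n})
    (\prod_(u | h u == None) clutterN u) * \prod_i massN (fiber h (Some i)))%R)%E.
Proof.
pose x0 : landmark R := point.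
pose F (h : {ffun Z -> option 'I_n}) j x :=
  (prior_rate S * prior_pdf S x * cell_likelihood S (nat_fiber h j) x)%:E.
pose c (h : {ffun Z -> option 'I_n}) :=
  (empty_factor * \prod_(u | h u == None) clutter_weight S u)%:E.
have mf h j : measurable_fun [set: landmark R]%classic
    (fun x => (prior_pdf S x * cell_likelihood S (nat_fiber h j) x)%:E : \bar R).
  apply/measurable_EFinP; apply: measurable_funM.
    exact: measurable_prior_pdf.
  exact: measurable_cell_likelihood.
have FE h j : F h j = fun x =>
    ((prior_rate S)%:E * (prior_pdf S x * cell_likelihood S (nat_fiber h j) x)%:E)%E.
  by apply/funext => x; rewrite -EFinM mulrA.
have p0 h j x : 0 <= prior_pdf S x * cell_likelihood S (nat_fiber h j) x.
  by rewrite mulr_ge0 ?prior_pdf_ge0 ?cell_likelihood_ge0.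
rewrite (@iterated_integral_sum_prod _ _ _ mu _ _ _ x0 c F); first last.
- move=> s us sn; subst n; rewrite (joint_density_seq x0 us) mulr_sumr -sumEFin.
  apply: eq_bigr => h _; rewrite mulrA EFinM; congr (_ * _)%E.
  by rewrite -prodEFin; apply: eq_bigr => i _; rewrite /F nat_fiberE.
- by move=> h j; rewrite FE; apply: measurable_funeM.
- by move=> h j x; rewrite FE mule_ge0 ?lee_fin ?prior_rate_ge0.
- move=> h; rewrite lee_fin mulr_ge0 ?(ltW empty_factor_gt0) // prodr_ge0 // => u _.
  exact: clutter_weight_ge0.
- exact: mu_nonatomic.
- exact: measurable_landmark1.
rewrite val_nne_sum ge0_sume_distrr; last by move=> h _; exact: valP.
apply: eq_bigr => h _; rewrite /c EFinM -muleA; congr (_ * _)%E.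
rewrite [RHS]/= -[LHS]/(_ * _)%E !val_nne_prod; congr (_ * _)%E; first by rewrite prodEFin.
apply: eq_bigr => i _; rewrite FE ge0_integralZl ?lee_fin ?prior_rate_ge0 //.
  by rewrite nat_fiberE.
by move=> x _; rewrite lee_fin.
Qed.

Let blockN (C : {set Z}) : nneR R := if finset.unset1 C is Some z then clutterN z else 0.

Let blockNE C : val (blockN C) = (cell_clutter C)%:E.
Proof. by rewrite /blockN /cell_clutter; case: finset.unset1. Qed.

Let weightN P (A : {set {set Z}}) : nneR R :=
  (\prod_(C in A) massN C) * \prod_(C in P :\: A) blockN C.

(** After integration the weights no longer depend on the label. [A] is the set of cells caused by
    landmarks, and each of the other [n - #|A|] landmarks contributes the mass of the empty cell. *)
Lemma iterated_integral_partition n :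
  iterated_integral mu n (fun s => (joint_density S Z [fset x in s])%:E) [::] =
  (empty_factor%:E * \sum_(P in batch_partitions Z) \sum_(A in powerset P)
     val (weightN P A) * (undetected_rate S ^+ (n - #|A|) * (n ^_ #|A|)%:R)%:E)%E.
Proof.
rewrite iterated_integral_joint_density (sum_splittings_partition clutterN (fun C _ => massN C)).
rewrite val_nne_sum; congr (_ * _)%E; apply: eq_big => [P|P _]; first by rewrite inE.
rewrite sum_labellings_support val_nne_sum; apply: eq_bigr => A _.
rewrite -/(weightN P A); rewrite [LHS]/=; congr (_ * _)%E.
by rewrite val_nneMn val_nneX [val (massN _)]/= cell_mass0 -EFin_expe -EFinM mulrC.
Qed.

Lemma evidence_partition :
  evidence S Z = ((empty_factor * expR (undetected_rate S))%:E *
    \sum_(P in batch_partitions Z) \prod_(C in P) (cell_mass S C + (cell_clutter C)%:E))%E.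
Proof.
have e0 : 0 <= empty_factor := ltW empty_factor_gt0; have u0 := undetected_rate_ge0 S.
pose a n j : R := undetected_rate S ^+ (n - j) * (n ^_ j)%:R / n`!%:R.
have a0 n j : 0 <= a n j.
  by rewrite /a mulr_ge0 ?invr_ge0 ?ler0n // mulr_ge0 ?exprn_ge0 ?ler0n.
pose I n := iterated_integral mu n (fun s => (joint_density S Z [fset x in s])%:E) [::].
have IE n : ((n`!%:R^-1)%:E * I n = \sum_(P in batch_partitions Z) \sum_(A in powerset P)
    (empty_factor%:E * val (weightN P A)) * (a n #|A|)%:E)%E.
  have W0 P (A : {set {set Z}}) : (0 <= val (weightN P A) *
     (undetected_rate S ^+ (n - #|A|) * (n ^_ #|A|)%:R)%:E)%E.
    by rewrite mule_ge0 ?(valP (weightN P A)) // lee_fin mulr_ge0 ?exprn_ge0 ?ler0n.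
  rewrite /I iterated_integral_partition muleA ge0_sume_distrr; last first.
    by move=> P _; apply: sume_ge0.
  apply: eq_bigr => P _; rewrite ge0_sume_distrr //; apply: eq_bigr => A _.
  rewrite /a (EFinM (undetected_rate S ^+ (n - #|A|) * (n ^_ #|A|)%:R)).
  rewrite [((n`!%:R^-1)%:E * _)%E]muleC -!muleA; congr (_ * _)%E.
  by rewrite muleCA; congr (_ * _)%E; rewrite muleC -muleA.
have I0 n : (0 <= (n`!%:R^-1)%:E * I n)%E.
  rewrite IE; apply: sume_ge0 => P _; apply: sume_ge0 => A _.
  by apply: mule_ge0; [apply: mule_ge0; [|exact: valP]|]; rewrite lee_fin.
(* The separate value at the empty set is the term [n = 0] of the series. *)
have -> : evidence S Z = (\sum_(0 <= n <oo) (n`!%:R^-1)%:E * I n)%E.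
  rewrite nneseries_recl //; congr (_ + _)%E.
  by rewrite fact0 invr1 mul1e /I /=; congr ((joint_density S Z _)%:E);
    apply/fsetP => x; rewrite !inE.
under eq_eseriesr do rewrite IE.
have EW0 P (A : {set {set Z}}) n : (0 <= empty_factor%:E * val (weightN P A) * (a n #|A|)%:E)%E.
  by apply: mule_ge0; [apply: mule_ge0; [|exact: valP]|]; rewrite lee_fin.
rewrite nneseries_sum; last by move=> P n _; apply: sume_ge0.
rewrite ge0_sume_distrr; last first.
  move=> P _; apply: prode_ge0 => C _; rewrite adde_ge0 ?cell_mass_ge0 //.
  by rewrite lee_fin cell_clutter_ge0.
apply: eq_bigr => P _; rewrite nneseries_sum //.
have -> : (\prod_(C in P) (cell_mass S C + (cell_clutter C)%:E))%E =
    val (\prod_(C in P) (massN C + blockN C))%R.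
  by rewrite val_nne_prod; apply: eq_bigr => C _; rewrite -blockNE.
(* Each cell is due either to a landmark or to clutter: the sum over [A] is the expansion of the
   product of [massN C + blockN C]. *)
rewrite prodrD_powerset val_nne_sum ge0_sume_distrr; last by move=> A _; exact: valP.
(* The weight of [A] may be infinite; the positive term required is the one at [n = #|A|], which
   equals [1]. *)
apply: eq_bigr => A _; rewrite (@ge0_nneseriesZl _ _ (fun n => a n #|A|) #|A|) //.
- by rewrite nneseries_ffact_exp // (EFinM empty_factor) [LHS]muleAC.
- by apply: mule_ge0; [rewrite lee_fin|exact: valP].
- by rewrite /a subnn expr0 mul1r ffactnn divff // pnatr_eq0 -lt0n fact_gt0.
Qed.

End evidence.

(** * The posterior *)

(** Taking images of blocks under [f] is injective on partitions. Used in both directions, this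
    gives equality of the two numbers. *)
Lemma leq_card_partitions (T U : finType) (f : T -> U) : bijective f ->
  (#|[set P : {set {set T}} | finset.partition P [set: T]]%SET|
   <= #|[set P : {set {set U}} | finset.partition P [set: U]]%SET|)%N.
Proof.
move=> bf; have fi := bij_inj bf.
pose F (P : {set {set T}}) : {set {set U}} :=
  finset.imset (fun B : {set T} => finset.imset f (mem B)) (mem P).
have Fi : injective F by apply: imset_inj; exact: imset_inj.
rewrite -(card_imset _ Fi); apply: subset_leq_card; apply/fintype.subsetP => Q.
case/imsetP => P; rewrite !inE => PT ->.
suff <- : finset.imset f (mem [set: T]%SET) = [set: U]%SET by rewrite imset_partition.
apply/setP => y; rewrite inE; have [g fK gK] := bf.
by apply/imsetP; exists (g y); rewrite ?inE ?gK.
Qed.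

Lemma card_batch_partitions (M : choiceType) (K : nat) (Z : {fset 'I_K * M}) :
  #|[set P : {set {set Z}} | finset.partition P [set: Z]]%SET| = bell #|` Z|.
Proof.
rewrite cardfE /bell; apply/eqP; rewrite eqn_leq; apply/andP; split.
  by apply: (@leq_card_partitions _ _ enum_rank); exists enum_val;
    [exact: enum_rankK|exact: enum_valK].
by apply: (@leq_card_partitions _ _ enum_val); exists enum_rank;
  [exact: enum_valK|exact: enum_rankK].
Qed.

(** * Finite products with possibly infinite factors *)

Section ereal_products.
Variables (R : realType) (T : finType) (P : {set T}) (m : T -> \bar R) (k : T -> R).
Hypotheses (m0 : forall C, (0 <= m C)%E) (k0 : forall C, 0 <= k C).
Hypothesis fin : (\prod_(C in P) (m C + (k C)%:E) < +oo)%E.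

Lemma fin_prod_dichotomy :
  (exists C, [/\ C \in P, m C = 0%E & k C = 0]) \/
  (forall C, C \in P -> m C \is a fin_num).
Proof.
have mk0 C : (0 <= m C + (k C)%:E)%E by rewrite adde_ge0 ?lee_fin.
case: (boolP [exists C in P, (m C + (k C)%:E == 0)%E]) => [/existsP[C /andP[CP]]|n0].
  by rewrite padde_eq0 ?lee_fin // => /andP[/eqP mC /eqP[kC]]; left; exists C.
(* With no zero factor, the remaining factors have a positive product, and an infinite [m C] would
   make the whole product infinite. *)
right=> C CP; rewrite ge0_fin_numE // ltey; apply/eqP => mC.
move: fin; rewrite (bigD1 C) //= mC addye // gt0_mulye ?ltxx //.
elim/big_ind: _ => // [x y x0 y0|D /andP[DP _]]; first exact: mule_gt0.
rewrite lt_neqAle mk0 andbT eq_sym; apply: contra n0 => D0.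
by apply/existsP; exists D; rewrite DP.
Qed.

(* As fine sends +oo to 0, this relies on the zero factor that accompanies any
   infinite one. *)
Lemma fin_prodE : (\prod_(C in P) (m C + (k C)%:E))%E = (\prod_(C in P) (k C + fine (m C)))%:E.
Proof.
case: fin_prod_dichotomy => [[C [CP mC kC]]|mfin].
  by rewrite (bigD1 C) //= mC kC adde0 mul0e (bigD1 C) //= mC kC addr0 mul0r.
rewrite -prodEFin; apply: eq_bigr => C CP.
by rewrite addrC EFinD fineK // mfin.
Qed.

End ereal_products.

(** * Normalized densities and null sets *)

Section normalizations.
Variables (R : realType) (d : measure_display) (T : measurableType d).
Variable mu : {measure set T -> \bar R}.
Variables f h : T -> R.
Hypotheses (mf : measurable_fun [set: T]%classic f) (mh : measurable_fun [set: T]%classic h).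
Hypotheses (f0 : forall x, 0 <= f x) (h0 : forall x, 0 <= h x).

Let mfh : measurable_fun [set: T]%classic (fun x => (f x * h x)%:E : \bar R).
Proof. by apply/measurable_EFinP; exact: measurable_funM. Qed.

Let int_ge0 : (0 <= \int[mu]_x (f x * h x)%:E)%E.
Proof. by apply: integral_ge0 => x _; rewrite lee_fin mulr_ge0. Qed.

Lemma normalization_pdf g : normalization mu f h g -> is_pdf mu g.
Proof.
rewrite /normalization; case: eqP => // /eqP i0 gE.
(* An infinite integral would give [inner] the value [0]. *)
have fin : (\int[mu]_x (f x * h x)%:E)%E \is a fin_num.
  move: i0; rewrite /inner /Rintegral; case: (\int[mu]_x _)%E => //=; by rewrite eqxx.
have ip : 0 < inner mu f h by rewrite lt_def i0 /= fine_ge0.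
have -> : g = fun x => (inner mu f h)^-1 * (f x * h x).
  by apply/funext => x; rewrite gE mulrC.
split.
- by apply: measurable_funM => //; exact: measurable_funM.
- by move=> x; rewrite !mulr_ge0 ?invr_ge0 ?(ltW ip).
- under eq_integral do rewrite EFinM.
  rewrite ge0_integralZl_EFin ?invr_ge0 ?(ltW ip) //; last first.
    by move=> x _; rewrite lee_fin mulr_ge0.
  by rewrite -[X in (_ * X)%E]fineK // -EFinM mulVf.
Qed.

(** A nonnegative function with zero integral vanishes almost everywhere. *)
Lemma negligible_hidden_mass : negligible mu (hidden_mass mu f h).
Proof.
have [i0|/eqP ni0] := eqVneq (\int[mu]_x (f x * h x)%:E)%E 0%E; last first.
  by apply: negligibleS (negligible_set0 mu) => x [].
have /(ae_eq_integral_abs mu measurableT mfh) [N [mN N0 sub]] :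
    (\int[mu]_x `|(f x * h x)%:E| = 0)%E.
  by rewrite -[RHS]i0; apply: eq_integral => x _; rewrite gee0_abs // lee_fin mulr_ge0.
exists N; split => // x [_ /eqP nz]; apply: sub => /= e; apply: nz.
by have [] := e Logic.I.
Qed.

Lemma normalizationE (a : R) g x : normalization mu f h g ->
  (a%:E * \int[mu]_y (f y * h y)%:E)%E \is a fin_num -> 0 <= a ->
  (0 < a -> ~ hidden_mass mu f h x) ->
  a * (f x * h x) = a * inner mu f h * g x.
Proof.
move=> gE fin; rewrite le_eqVlt => /orP[/eqP <-|a0 /(_ a0) nh]; first by rewrite !mul0r.
move: gE; rewrite /normalization; case: eqVneq => [i0 _|i0 ->]; last first.
  by rewrite -mulrA; congr (_ * _); rewrite [RHS]mulrC divfK.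
rewrite i0 mulr0 mul0r.
(* A zero [inner] could also come from an infinite integral. Finiteness of the product with [a > 0]
   excludes this, so the integral is zero and off the hidden mass the integrand vanishes at [x]. *)
have ifin : (\int[mu]_y (f y * h y)%:E)%E \is a fin_num.
  by move: fin; case: (\int[mu]_y _)%E int_ge0 => // _; rewrite gt0_muley ?lte_fin.
have int0 : (\int[mu]_y (f y * h y)%:E = 0)%E.
  by rewrite -[LHS]fineK // -[fine _]/(inner mu f h) i0.
case: (eqVneq (f x * h x) 0) => [->|fh]; first by rewrite mulr0.
by case: nh.
Qed.

End normalizations.

Lemma bernoulli_density_option (R : realType) (T : choiceType) (X : {fset T})
    (r : R) (f : T -> R) (o : option X) :
  bernoulli_density r f (fset_of_option o) = if o is Some x then r * f (val x) else 1 - r.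
Proof.
rewrite /bernoulli_density; case: o => [x|] /=.
  have : size (enum_fset [fset val x]) = 1%N by exact: cardfs1.
  case E: (enum_fset _) => [|y [|? ?]] // _.
  have : y \in [fset val x] by change (y \in enum_fset [fset val x]); rewrite E mem_head.
  by rewrite in_fset1 => /eqP ->.
by have := cardfs0 T; case: (enum_fset fset0).
Qed.

(** * Weights, parameters and mixture form of the posterior *)

Section posterior.
Variables (R : realType) (d : measure_display) (M : measurableType d).
Variables (mu : {measure set (landmark R) -> \bar R}).
Variables (nu : {measure set M -> \bar R}) (K : nat).
Variables (S : slam_model mu nu K) (Z : {fset 'I_K * M}).
Implicit Types (C : {set Z}) (P : {set {set Z}}) (x : landmark R).

(** There are finitely many cells, so this is contained in a finite union of null sets. *)
Lemma negligible_exceptional : negligible mu (exceptional S Z).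
Proof.
pose E (s : seq {set Z}) : set (landmark R) := [set x | exists2 C, C \in s &
  hidden_mass mu (prior_pdf S) (cell_likelihood S C) x]%classic.
have negE s : negligible mu (E s).
  elim: s => [|C s IH].
    by apply: negligibleS (negligible_set0 mu) => x [].
  apply: negligibleS (negligibleU (A := hidden_mass mu (prior_pdf S) (cell_likelihood S C)) _ IH).
    move=> x [D]; rewrite in_cons => /orP[/eqP -> ?|Ds hD]; [by left|].
    by right; exists D.
  apply: negligible_hidden_mass.
  - exact: measurable_prior_pdf.
  - exact: measurable_cell_likelihood.
  - exact: prior_pdf_ge0.
  - exact: cell_likelihood_ge0.
apply: negligibleS (negligibleU
  (A := hidden_mass mu (prior_pdf S) (undetected S)) _ (negE (enum {set Z}))).
  move=> x [_ [?|[C _ hC]]]; [by left|].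
  by right; exists C; rewrite ?mem_enum.
apply: negligible_hidden_mass.
- exact: measurable_prior_pdf.
- exact: measurable_undetected.
- exact: prior_pdf_ge0.
- by move=> x; case/andP: (undetected_itv S x).
Qed.

Lemma cell_weightE C : cell_weight S C = cell_clutter S C + fine (cell_mass S C).
Proof.
rewrite /cell_weight /cell_clutter fine_cell_mass.
by case: finset.unset1 => [u|]; rewrite ?add0r.
Qed.

Lemma detected_mass_ge0 C : 0 <= detected_mass S C.
Proof. by rewrite -fine_cell_mass fine_ge0 ?cell_mass_ge0. Qed.

Lemma cell_weight_ge0 C : 0 <= cell_weight S C.
Proof. by rewrite cell_weightE addr_ge0 ?cell_clutter_ge0 ?fine_ge0 ?cell_mass_ge0. Qed.

Lemma existence_probability_itv C r : existence_probability S C r -> 0 <= r <= 1.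
Proof.
have m0 := detected_mass_ge0 C; rewrite /existence_probability.
case: finset.unset1 => [u /=|-> ]; last by rewrite ler01 lexx.
have k0 := clutter_weight_ge0 S u; rewrite -/(clutter_weight S u).
case: (eqVneq (clutter_weight S u + detected_mass S C) 0) => [t0 [+ _]|t0 [_ ->//]]; first exact.
by rewrite divr_ge0 ?addr_ge0 // ler_pdivrMr ?lt_def ?t0 ?addr_ge0 // mul1r lerDr.
Qed.

(** The cell weight times the Bernoulli probabilities of presence and absence gives back the
    detected mass and the clutter weight. If the weight is zero then so are both of its summands,
    and an arbitrary [r] will do. *)
Lemma existence_probability_split C r : existence_probability S C r ->
  cell_weight S C * r = detected_mass S C /\ cell_weight S C * (1 - r) = cell_clutter S C.
Proof.
have m0 := detected_mass_ge0 C; rewrite /existence_probability /cell_weight /cell_clutter.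
case: finset.unset1 => [u /=|->]; last by rewrite subrr mulr0 mulr1.
have k0 := clutter_weight_ge0 S u; rewrite -/(clutter_weight S u) => -[_ rE].
case: (eqVneq (clutter_weight S u + detected_mass S C) 0) => [t0|t0].
  by rewrite t0 !mul0r; move/eqP: t0; rewrite paddr_eq0 // => /andP[/eqP -> /eqP ->].
by rewrite rE // mulrBr mulr1 mulrC divfK // addrK.
Qed.

Hypothesis mu_nonatomic : forall x : landmark R, (mu [set x]%classic = 0)%E.
Hypothesis evidence_pos_fin : (0 < evidence S Z < +oo)%E.

Let total := \sum_(P in batch_partitions Z) \prod_(C in P) cell_weight S C.
Let scale := empty_factor S * expR (undetected_rate S).

Let scale_gt0 : 0 < scale.
Proof. by rewrite mulr_gt0 ?expR_gt0 ?empty_factor_gt0. Qed.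

(** The evidence is finite and is a positive multiple of a sum of nonnegative terms, hence each term
    is finite. *)
Let fin_cells P : P \in batch_partitions Z ->
  (\prod_(C in P) (cell_mass S C + (cell_clutter S C)%:E) < +oo)%E.
Proof.
move=> PT; have g0 (Q : {set {set Z}}) :
    (0 <= \prod_(C in Q) (cell_mass S C + (cell_clutter S C)%:E))%E.
  apply: prode_ge0 => C _.
  by rewrite adde_ge0 ?cell_mass_ge0 ?lee_fin ?cell_clutter_ge0.
rewrite ltey; apply/eqP => Poo; move: evidence_pos_fin => /andP[_].
rewrite evidence_partition // (bigD1 P) //= Poo addye; last first.
  by rewrite gt_eqF // (lt_le_trans ltNy0) // sume_ge0.
by rewrite gt0_muley ?lte_fin // ltxx.
Qed.

Lemma evidenceE : evidence S Z = (scale * total)%:E.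
Proof.
rewrite evidence_partition // -/scale [RHS]EFinM; congr (_ * _)%E; rewrite -sumEFin.
apply: eq_bigr => P PT; rewrite fin_prodE //; last exact: fin_cells.
- by congr EFin; apply: eq_bigr => C _; rewrite cell_weightE.
- by move=> C; exact: cell_mass_ge0.
- by move=> C; exact: cell_clutter_ge0.
Qed.

Lemma total_weight_gt0 : 0 < total.
Proof.
by move: evidence_pos_fin; rewrite evidenceE lte_fin pmulr_rgt0 // => /andP[].
Qed.

Variables (rK : {set Z} -> R) (fK : {set Z} -> landmark R -> R) (fU : landmark R -> R).
Hypothesis rKP : forall C, C != finset.set0 -> existence_probability S C (rK C).
Hypothesis fKP : forall C, C != finset.set0 ->
  normalization mu (prior_pdf S) (cell_likelihood S C) (fK C).
Hypothesis fUP : normalization mu (prior_pdf S) (undetected S) fU.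

Variable X : {fset landmark R}.
Hypothesis regular : forall x, x \in X -> ~ exceptional S Z x.

Let cell_factor C x := prior_rate S * prior_pdf S x * cell_likelihood S C x.

Let undetected_factor x : x \in X -> cell_factor finset.set0 x = undetected_rate S * fU x.
Proof.
move=> xX; rewrite /cell_factor cell_likelihood0 -mulrA /undetected_rate.
apply: (normalizationE _ _ fUP) => //.
- exact: prior_pdf_ge0.
- by move=> y; case/andP: (undetected_itv S y).
- have /andP[i0 i1] := integral_prior_undetected_le1 S.
  by rewrite fin_numM // ge0_fin_numE // (le_lt_trans i1) // ltry.
- exact: prior_rate_ge0.
- by move=> l0 hx; case: (regular xX); split => //; left.
Qed.

Let detected_factor C x : x \in X -> C != finset.set0 -> cell_mass S C \is a fin_num ->
  cell_factor C x = cell_weight S C * (rK C * fK C x).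
Proof.
move=> xX C0 fin; have [rE _] := existence_probability_split (rKP C0).
rewrite mulrA rE /cell_factor -mulrA /detected_mass.
apply: (normalizationE _ _ (fKP C0)) => //.
- exact: prior_pdf_ge0.
- exact: cell_likelihood_ge0.
- exact: prior_rate_ge0.
- by move=> l0 hx; case: (regular xX); split => //; right; exists C.
Qed.

(** The factor vanishes at every point of [X], not just almost everywhere, as these points are not
    exceptional. *)
Let massless_factor C x : x \in X -> C != finset.set0 -> cell_mass S C = 0%E ->
  cell_factor C x = 0.
Proof.
move=> xX C0 m0; rewrite detected_factor ?m0 // mulrA.
have [-> _] := existence_probability_split (rKP C0).
by rewrite -fine_cell_mass m0 mul0r.
Qed.

Let labelled_product P (b : {set Z} -> option X) : P \in batch_partitions Z ->
  \prod_(C in P) block_weight (@clutter_weight _ _ _ _ _ _ S Z)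
      (fun C (x : X) => cell_factor C (val x)) C (b C) =
  (\prod_(C in P) cell_weight S C)
  * \prod_(C in P) bernoulli_density (rK C) (fK C) (fset_of_option (b C)).
Proof.
move=> PT; have PT' : finset.partition P [set: Z]%SET by move: PT; rewrite inE.
have P0 C : C \in P -> C != finset.set0.
  by case/and3P: PT' => _ _ n0 CP; apply: contraNneq n0 => <-.
rewrite -big_split /=.
(* In the first case some cell has zero weight for every label, and both products vanish even if
   another mass is infinite. In the second all masses are finite and the factors agree cell by
   cell. *)
case: (fin_prod_dichotomy (fun C => cell_mass_ge0 S C) (fun C => cell_clutter_ge0 S C)
         (fin_cells PT)) => [[C [CP mC kC]]|mfin].
  rewrite (bigD1 C) //= [RHS](bigD1 C) //= cell_weightE mC kC addr0 !mul0r.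
  rewrite /block_weight; case: (b C) => [x|]; last by rewrite -/(cell_clutter S C) kC mul0r.
  by rewrite massless_factor ?P0 ?mul0r //; exact: valP.
apply: eq_bigr => C CP; rewrite bernoulli_density_option /block_weight.
case: (b C) => [x|]; first by rewrite detected_factor ?P0 ?mfin //; exact: valP.
by have [_ ->] := existence_probability_split (rKP (P0 _ CP)).
Qed.

Lemma posterior_pmbm : posterior S Z X = pmbm_density S rK fK fU X.
Proof.
have t0 := total_weight_gt0; have s0 := scale_gt0.
pose V C A := bernoulli_density (rK C) (fK C) A.
pose u x := undetected_rate S * fU x.
(* The mixture is rewritten as a sum over partitions and labellings, to be compared term by term
   with the joint density. *)
have -> : pmbm_density S rK fK fU X = \sum_(P in batch_partitions Z)
    partition_weight S P * expR (- undetected_rate S) *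
    \sum_(b : {ffun {set Z} -> option X} | labelling P b)
      (\prod_(C in P) V C (fset_of_option (b C))) * \prod_(x | Some x \notin codom b) u (val x).
  under [RHS]eq_bigr do rewrite sum_labellings_assignments mulr_sumr.
  rewrite exchange_big /=; apply: eq_bigr => D _; rewrite mulr_suml.
  apply: eq_bigr => P _; rewrite /poisson_density -!mulrA; congr (_ * (_ * _)).
  exact: mulrCA.
rewrite /posterior joint_density_splittings evidenceE /=.
rewrite (sum_splittings_partition (@clutter_weight _ _ _ _ _ _ S Z)
  (fun C (x : X) => cell_factor C (val x))).
rewrite mulrAC mulr_sumr; apply: eq_big => [P|P PT]; first by rewrite inE.
have PB : P \in batch_partitions Z by rewrite inE.
rewrite /partition_weight -/total [LHS]mulr_sumr [RHS]mulr_sumr; apply: eq_bigr => b _.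
rewrite labelled_product // -/(empty_factor S) /scale.
rewrite (eq_bigr (fun x : X => u (val x))); last first.
  by move=> x _; rewrite undetected_factor //; exact: valP.
have e0 : expR (undetected_rate S) != 0 by rewrite gt_eqF ?expR_gt0.
have c0 : empty_factor S != 0 by rewrite gt_eqF ?empty_factor_gt0.
have tn0 : total != 0 by rewrite gt_eqF.
(* Dividing by the evidence cancels [empty_factor]; what remains is the exponential of minus the
   undetected rate and the division by [total]. *)
rewrite expRN /V; move: (\prod_(C in P) bernoulli_density _ _ _) (\prod_(C in P) _) => bp cw.
by field; rewrite e0 tn0 c0.
Qed.

End posterior.

Theorem theorem1 (R : realType) (d : measure_display) (M : measurableType d)
    (mu : {sigma_finite_measure set (landmark R) -> \bar R})
    (nu : {measure set M -> \bar R}) (K : nat)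
    (S : slam_model mu nu K) (Z : {fset 'I_K * M})
    (rK : {set Z} -> R) (fK : {set Z} -> landmark R -> R)
    (fU : landmark R -> R)
    (mu_nonatomic : forall x : landmark R, (mu [set x]%classic = 0)%E)
    (evidence_pos_fin : (0 < evidence S Z < +oo)%E)
    (rKP : forall C : {set Z}, C != finset.set0 -> existence_probability S C (rK C))
    (fKP : forall C : {set Z}, C != finset.set0 ->
       normalization mu (prior_pdf S) (cell_likelihood S C) (fK C))
    (fUP : normalization mu (prior_pdf S) (undetected S) fU) :
  [/\ #|batch_partitions Z| = bell #|` Z|,
      (forall P : {set {set Z}}, P \in batch_partitions Z ->
         0 <= partition_weight S P)
      /\ \sum_(P in batch_partitions Z) partition_weight S P = 1,
      (forall C : {set Z}, C != finset.set0 ->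
         0 <= rK C <= 1 /\ is_pdf mu (fK C)),
      0 <= undetected_rate S /\ is_pdf mu fU
    & negligible mu (exceptional S Z) /\
      forall X : {fset landmark R},
        (forall x : landmark R, x \in X -> ~ exceptional S Z x) ->
        posterior S Z X = pmbm_density S rK fK fU X].
Proof.
have total_gt0 := total_weight_gt0 mu_nonatomic evidence_pos_fin.
split.
- exact: card_batch_partitions.
- split=> [P _|]; last by rewrite -mulr_suml divff // gt_eqF.
  by rewrite divr_ge0 ?(ltW total_gt0) // prodr_ge0 // => C _; exact: cell_weight_ge0.
- move=> C C0; split; first exact: existence_probability_itv (rKP C C0).
  apply: normalization_pdf (fKP C C0).
  + exact: measurable_prior_pdf.
  + exact: measurable_cell_likelihood.
  + exact: prior_pdf_ge0.
  + exact: cell_likelihood_ge0.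
- split; first exact: undetected_rate_ge0.
  apply: normalization_pdf fUP.
  + exact: measurable_prior_pdf.
  + exact: measurable_undetected.
  + exact: prior_pdf_ge0.
  + by move=> x; case/andP: (undetected_itv S x).
- split; first exact: negligible_exceptional.
  by move=> X regular; exact: posterior_pmbm.
Qed.
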